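(* The futures opening auction problem (as defined in the context) can be solved in polynomial time. That is, there is an algorithm which, given any instance $(T,I,Q,p,\overline{\delta})$ with integer data encoded in binary, computes an optimal solution $(\delta,\pi)\in\mathbb{Z}^I\times\mathbb{Z}^T$ of the problem in time polynomial in the encoding length of the instance.
   Context: Instance. $T$ is a finite, totally ordered set of contracts, and $T'=T\cup\{\circ\}$ is obtained by adding a new maximum element $\circ$. $I$ is a finite set of orders. Each order $i\in I$ is associated with an arc $(r_i,s_i)\in T'\times T'$ with $r_i\ne s_i$ (demand $r_i$, offer $s_i$), an integer limit price, and a maximal quantity $\overline{\delta}_i\in\{1,2,3,\dots\}$. For $i\in I$ and $t\in T$: $Q_{i,t}=+1$ if $t=r_i$, $Q_{i,t}=-1$ if $t=s_i$, and $Q_{i,t}=0$ otherwise; $p_{i,t}\in\mathbb{Z}$ equals the limit price of order $i$ if $t=\min\{r_i,s_i\}$, and $p_{i,t}=0$ otherwise. Futures opening auction problem. Find $\delta\in\mathbb{Z}^I$ and $\pi\in\mathbb{Z}^T$ maximizing the executed volume $\sum_{i\in I}\delta_i$ subject to: (clearing) $\sum_{i\in I}Q_{i,t}\delta_i=0$ for all $t\in T$; (quantity) $0\le\delta_i\le\overline{\delta}_i$ for all $i\in I$; (price conditions) for all $i\in I$: if $\delta_i>0$ then $\sum_{t\in T}(p_{i,t}-\pi_t)Q_{i,t}\ge0$; and if $\delta_i<\overline{\delta}_i$ then $\sum_{t\in T}(p_{i,t}-\pi_t)Q_{i,t}\le0$. A pair $(\delta,\pi)$ satisfying all these constraints is a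 feasible solution; it is optimal if it maximizes $\sum_{i\in I}\delta_i$ among feasible solutions. *)

(* Defs.v *)
From HB Require Import structures.
From mathcomp Require Import all_boot all_order all_algebra.

Set Implicit Arguments.
Unset Strict Implicit.
Unset Printing Implicit Defensive.

Import Order.TTheory GRing.Theory Num.Theory.
Local Open Scope ring_scope.

(** * The futures opening auction problem *)

(* The contracts are T = 'I_nT, named by their rank in the total order, and
   T' = 'I_nT.+1, so that the added maximum is [ord_max : 'I_nT.+1]. *)
Record auction := Auction {
  nT : nat;
  nI : nat;
  demand : 'I_nI -> 'I_nT.+1;
  offer : 'I_nI -> 'I_nT.+1;
  demand_neq_offer : forall i, demand i != offer i;
  limit_price : 'I_nI -> int;
  max_qty : 'I_nI -> int;
  max_qty_gt0 : forall i, 0 < max_qty i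
}.

Section Auction.
Variable X : auction.

(* The inclusion of T in T'. *)
Definition in_T' (t : 'I_(nT X)) : 'I_(nT X).+1 := widen_ord (leqnSn _) t.

Definition Q (i : 'I_(nI X)) (t : 'I_(nT X)) : int :=
  if in_T' t == demand i then 1 else if in_T' t == offer i then -1 else 0.

Definition p (i : 'I_(nI X)) (t : 'I_(nT X)) : int :=
  if in_T' t == Order.min (demand i) (offer i) then limit_price i else 0.

Definition surplus (pi : 'I_(nT X) -> int) (i : 'I_(nI X)) : int :=
  \sum_(t < nT X) (p i t - pi t) * Q i t.

Definition feasible (delta : 'I_(nI X) -> int) (pi : 'I_(nT X) -> int) : Prop :=
  [/\ forall t, \sum_(i < nI X) Q i t * delta i = 0,
      forall i, 0 <= delta i <= max_qty i,
      forall i, 0 < delta i -> 0 <= surplus pi i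
    & forall i, delta i < max_qty i -> surplus pi i <= 0].

Definition optimal (delta : 'I_(nI X) -> int) (pi : 'I_(nT X) -> int) : Prop :=
  feasible delta pi /\
  forall delta' pi', feasible delta' pi' ->
    \sum_(i < nI X) delta' i <= \sum_(i < nI X) delta i.

(* The cardinalities of T and I, the elements of T in increasing order, the
   elements of I, the matrices Q and p row by row, and the maximal quantities.
   Listing T makes the encoding length at least |T| even when I is empty, as it
   must be since the output contains one price for each contract. *)
Definition encode : seq int :=
  [:: (nT X)%:Z; (nI X)%:Z]
  ++ [seq (val t)%:Z | t <- enum 'I_(nT X)]
  ++ [seq (val i)%:Z | i <- enum 'I_(nI X)]
  ++ [seq Q i t | i <- enum 'I_(nI X), t <- enum 'I_(nT X)]
  ++ [seq p i t | i <- enum 'I_(nI X), t <- enum 'I_(nT X)]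
  ++ [seq max_qty i | i <- enum 'I_(nI X)].

End Auction.

(* The length of the binary notation of |z|. *)
Definition bitsize (z : int) : nat := (trunc_log 2 `|z|%N).+1.

Definition encoding_length (X : auction) : nat :=
  (\sum_(z <- encode X) bitsize z)%N.

(** * Random access machines with logarithmic cost *)

(* The memory is a family of integer arrays indexed by nat (a given program
   names finitely many of them, so that they can be interleaved in a single
   array).  Control is structured instead of being given by jumps. *)
Definition memory := nat -> int -> int.

Inductive binop := Add | Sub | Mul | Div.

Inductive expr :=
  | Const of int
  | Read of nat & expr
  | Bin of binop & expr & expr.

Inductive program :=
  | Skip
  | Write of nat & expr & expr
  | Seq of program & program
  | IfPos of expr & program & program
  | WhilePos of expr & program.

Definition eval_binop (o : binop) (x y : int) : int :=
  match o with
  | Add => x + y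
  | Sub => x - y
  | Mul => x * y
  | Div => (x %/ y)%Z
  end.

Fixpoint eval (m : memory) (e : expr) : int :=
  match e with
  | Const z => z
  | Read a e1 => m a (eval m e1)
  | Bin o e1 e2 => eval_binop o (eval m e1) (eval m e2)
  end.

(* Memory accesses are charged the length of the address and of the contents;
   the product of the lengths of the operands bounds, up to a constant factor,
   the number of bit operations of each arithmetic operation. *)
Fixpoint eval_cost (m : memory) (e : expr) : nat :=
  match e with
  | Const z => bitsize z
  | Read a e1 =>
      (eval_cost m e1 + bitsize (eval m e1) + bitsize (m a (eval m e1)))%N
  | Bin o e1 e2 =>
      (eval_cost m e1 + eval_cost m e2
       + bitsize (eval m e1) * bitsize (eval m e2))%N
  end.

Definition update (m : memory) (a : nat) (j z : int) : memory :=
  fun b k => if (b == a) && (k == j) then z else m b k.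

(* [exec c m m' k]: started in memory m, the program c halts in memory m' after
   running for time k. *)
Inductive exec : program -> memory -> memory -> nat -> Prop :=
  | ExecSkip m : exec Skip m m 1
  | ExecWrite a e1 e2 m :
      exec (Write a e1 e2) m (update m a (eval m e1) (eval m e2))
        (eval_cost m e1 + eval_cost m e2
         + bitsize (eval m e1) + bitsize (eval m e2))
  | ExecSeq c1 c2 m1 m2 m3 k1 k2 :
      exec c1 m1 m2 k1 -> exec c2 m2 m3 k2 ->
      exec (Seq c1 c2) m1 m3 (k1 + k2).+1
  | ExecIfTrue e c1 c2 m1 m2 k :
      0 < eval m1 e -> exec c1 m1 m2 k ->
      exec (IfPos e c1 c2) m1 m2 (eval_cost m1 e + k).+1
  | ExecIfFalse e c1 c2 m1 m2 k :
      eval m1 e <= 0 -> exec c2 m1 m2 k ->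
      exec (IfPos e c1 c2) m1 m2 (eval_cost m1 e + k).+1
  | ExecWhileTrue e c m1 m2 m3 k1 k2 :
      0 < eval m1 e -> exec c m1 m2 k1 -> exec (WhilePos e c) m2 m3 k2 ->
      exec (WhilePos e c) m1 m3 (eval_cost m1 e + k1 + k2).+1
  | ExecWhileFalse e c m :
      eval m e <= 0 -> exec (WhilePos e c) m m (eval_cost m e).+1.

Lemma exec_deterministic c m m1 m2 k1 k2 :
  exec c m m1 k1 -> exec c m m2 k2 -> m1 = m2 /\ k1 = k2.
Proof.
have absurd (z : int) : 0 < z -> z <= 0 -> False by rewrite leNgt => ->.
move=> E1; elim: E1 m2 k2 => {c m m1 k1}.
- by move=> m m2 k2 E; inversion E.
- by move=> a e1 e2 m m2 k2 E; inversion E.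
- move=> c1 c2 m1 m2 m3 k1 k2 _ IH1 _ IH2 m' k' E.
  inversion E as [| |? ? ? ? ? ? ? F1 F2| | | |]; subst.
  by case: (IH1 _ _ F1) => ? ?; subst; case: (IH2 _ _ F2) => -> ->.
- move=> e c1 c2 m1 m2 k gt0 _ IH m' k' E.
  inversion E as [| | |? ? ? ? ? ? _ F|? ? ? ? ? ? le0 _| |]; subst.
    by case: (IH _ _ F) => -> ->.
  by case: (absurd _ gt0 le0).
- move=> e c1 c2 m1 m2 k le0 _ IH m' k' E.
  inversion E as [| | |? ? ? ? ? ? gt0 _|? ? ? ? ? ? _ F| |]; subst.
    by case: (absurd _ gt0 le0).
  by case: (IH _ _ F) => -> ->.
- move=> e c m1 m2 m3 k1 k2 gt0 _ IH1 _ IH2 m' k' E.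
  inversion E as [| | | | |? ? ? ? ? ? ? _ F1 F2|? ? ? le0]; subst.
    by case: (IH1 _ _ F1) => ? ?; subst; case: (IH2 _ _ F2) => -> ->.
  by case: (absurd _ gt0 le0).
- move=> e c m le0 m' k' E.
  inversion E as [| | | | |? ? ? ? ? ? ? gt0 _ _|]; subst => //.
  by case: (absurd _ gt0 le0).
Qed.

(* The input is in array 0; all other cells contain 0. *)
Definition init_memory (s : seq int) : memory :=
  fun a j => if (a == 0%N) && (0 <= j) then nth 0 s `|j|%N else 0.

(* The quantities are output in array 1 and the prices in array 2. *)
Definition output_delta (X : auction) (m : memory) : 'I_(nI X) -> int :=
  fun i => m 1%N (val i)%:Z.

Definition output_pi (X : auction) (m : memory) : 'I_(nT X) -> int :=
  fun t => m 2%N (val t)%:Z.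

Arguments output_delta : clear implicits.
Arguments output_pi : clear implicits.

(* Main.v *)
Require Import Defs.
From mathcomp Require Import all_boot all_order all_algebra.
From mathcomp Require Import zify ring.

(** Read order i as an arc from its offer to its demand, with capacity its
    maximal quantity and gain b_i = sum_t p_(i,t) Q_(i,t).  Then delta is a
    circulation, the surplus of an order is the reduced gain of its arc for the
    potential pi extended by 0 at the added maximum, and the price conditions are
    complementary slackness.

    For an arbitrary gain c, an optimal pair (circulation, potential) is found by
    scaling capacities: pass from u %/ 2^(k+1) to u %/ 2^k by doubling
    everything and then adding at most one unit of capacity per arc.  If the
    enlarged arc has positive reduced gain, push a unit through it and bring the
    unit back along a residual path of tight arcs, found by growing a search
    tree and raising the potentials of the reached vertices by the smallest
    slack of a leaving arc.

    This is run twice: with gain b, which yields the prices, and with gain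
    M b + 1 for M larger than the total capacity, which yields a circulation
    optimal for b and, among those, of maximal volume.  By linear programming
    duality any optimal circulation satisfies slackness with any optimal
    potential, so the two outputs can be combined. *)

Set Implicit Arguments.
Unset Strict Implicit.
Unset Printing Implicit Defensive.

Import Order.TTheory GRing.Theory Num.Theory.
Local Open Scope ring_scope.

(** * Running time of structured programs *)

(** The program is fixed, so its running time is polynomial once two quantities are: a common bound
    on the iterations of all loops and a common bound on the bit lengths of all cells. Loop nesting
    only fixes the degree. Potentials may therefore grow exponentially, provided the exponent is
    polynomial.

    Doubling capacities and quantities preserves slackness: no reduced gain changes, saturated arcs
    stay saturated and empty arcs stay empty. An extra unit of capacity can break slackness only on
    an arc of positive reduced gain; that arc was saturated, and filling the unit leaves an
    imbalance at its two ends only. So one path per arc and phase repairs everything.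

    The price conditions, which tie quantities to prices, are what makes the problem look harder
    than a linear program. But the feasible pairs are exactly the pairs of an optimal circulation
    and an optimal potential for b, and these two sets combine freely; what remains is to maximize
    volume among optimal circulations. The weight M achieves this because gains are integers: losing
    one unit of b costs M, more than any volume can make up. *)

Lemma bitsize_gt0 z : (0 < bitsize z)%N.
Proof. by []. Qed.

Lemma bitsize_le (b : nat) (z : int) :
  (0 < b)%N -> (bitsize z <= b)%N = (`|z| < 2 ^ b)%N.
Proof.
move=> b0; rewrite /bitsize; case: (posnP `|z|%N) => [->|z0].
  by rewrite trunc_log0 b0 expn_gt0.
apply/idP/idP => [le|lt].
  by apply: leq_trans (@trunc_log_ltn 2 _ isT) _; rewrite leq_exp2l.
by rewrite -(ltn_exp2l _ _ (isT : 1 < 2)%N) (leq_ltn_trans _ lt) ?trunc_logP.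
Qed.

(** Measured in multiples of the bound b on cell lengths. A sum or quotient is charged like a
    product, by adding the lengths of the operands; this is crude but uniform in the operation. *)
Fixpoint expr_bits (e : expr) : nat :=
  match e with
  | Const z => bitsize z
  | Read _ _ => 1
  | Bin _ e1 e2 => expr_bits e1 + expr_bits e2
  end.

Fixpoint expr_cost (e : expr) : nat :=
  match e with
  | Const z => bitsize z
  | Read _ e1 => expr_cost e1 + expr_bits e1 + 1
  | Bin _ e1 e2 => expr_cost e1 + expr_cost e2 + expr_bits e1 * expr_bits e2
  end.

(* The cost of running [c] in units of b^2, where b bounds the bit lengths of
   all memory cells, when every loop makes at most n iterations. *)
Fixpoint prog_cost (n : nat) (c : program) : nat :=
  match c with
  | Skip => 1
  | Write _ e1 e2 =>
      expr_cost e1 + expr_cost e2 + expr_bits e1 + expr_bits e2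
  | Seq c1 c2 => prog_cost n c1 + prog_cost n c2 + 1
  | IfPos e c1 c2 => expr_cost e + prog_cost n c1 + prog_cost n c2 + 1
  | WhilePos e c1 => n * (expr_cost e + prog_cost n c1 + 1) + expr_cost e + 1
  end.

Definition bounded (b : nat) (m : memory) :=
  forall a j, (`|m a j| < 2 ^ b)%N.

Lemma eval_bits b m e : (0 < b)%N -> bounded b m ->
  (bitsize (eval m e) <= expr_bits e * b)%N.
Proof.
move=> b0 mb; elim: e => [z|a e IH|o e1 IH1 e2 IH2] /=.
- by rewrite leq_pmulr.
- by rewrite mul1n bitsize_le.
have p1 : (0 < expr_bits e1 * b)%N by exact: leq_trans IH1.
have p2 : (0 < expr_bits e2 * b)%N by exact: leq_trans IH2.
move: IH1 IH2; rewrite !bitsize_le ?mulnDl ?addn_gt0 ?p1 //.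
set x := eval m e1; set y := eval m e2.
move: p1 p2; set u := (_ * b)%N; set v := (_ * b)%N => p1 p2 Hx Hy.
(* Both exponents are positive, so each power is at least 2 and their sum is at most their
   product. *)
have aux (k l : nat) : (k < 2 ^ u -> l < 2 ^ v -> k + l < 2 ^ (u + v))%N.
  move=> Hk Hl; rewrite expnD.
  have : (2 ^ 1 <= 2 ^ u)%N by rewrite leq_exp2l.
  have : (2 ^ 1 <= 2 ^ v)%N by rewrite leq_exp2l.
  by rewrite expn1; nia.
case: o => /=.
- by apply: leq_ltn_trans (aux _ _ Hx Hy); lia.
- by apply: leq_ltn_trans (aux _ _ Hx Hy); lia.
- by rewrite abszM expnD; apply: ltn_mul.
- by apply: leq_ltn_trans (aux _ _ Hx Hy); have := lez_div x y; lia.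
Qed.

Lemma eval_cost_le b m e : (0 < b)%N -> bounded b m ->
  (eval_cost m e <= expr_cost e * b ^ 2)%N.
Proof.
move=> b0 mb; have bb : (b <= b ^ 2)%N by rewrite -[X in (X <= _)%N]expn1 leq_pexp2l.
elim: e => [z|a e IH|o e1 IH1 e2 IH2] /=.
- by rewrite leq_pmulr // expn_gt0 b0.
- have H := eval_bits e b0 mb.
  have : (bitsize (m a (eval m e)) <= b)%N by rewrite bitsize_le.
  have := leq_mul (leqnn (expr_bits e)) bb.
  lia.
- have H1 := eval_bits e1 b0 mb; have H2 := eval_bits e2 b0 mb.
  have := leq_mul H1 H2; lia.
Qed.

Fixpoint writes (c : program) : seq nat :=
  match c with
  | Skip => [::]
  | Write a _ _ => [:: a]
  | Seq c1 c2 | IfPos _ c1 c2 => writes c1 ++ writes c2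
  | WhilePos _ c1 => writes c1
  end.

Lemma exec_frame c m m' k : exec c m m' k ->
  forall a, a \notin writes c -> m' a = m a.
Proof.
elim=> {c m m' k} //=.
- move=> a e1 e2 m b; rewrite inE /update => /negbTE ->; by [].
- move=> c1 c2 m1 m2 m3 k1 k2 _ IH1 _ IH2 a; rewrite mem_cat negb_or.
  by case/andP=> a1 a2; rewrite IH2 // IH1.
- move=> e c1 c2 m1 m2 k _ _ IH a; rewrite mem_cat negb_or.
  by case/andP=> a1 a2; rewrite IH.
- move=> e c1 c2 m1 m2 k _ _ IH a; rewrite mem_cat negb_or.
  by case/andP=> a1 a2; rewrite IH.
- by move=> e c m1 m2 m3 k1 k2 _ _ IH1 _ IH2 a ha; rewrite IH2 // IH1.
Qed.

(** Total correctness: the execution is produced, not assumed. The bound on the memory is threaded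
    through because it converts the syntactic cost into time. *)
Definition wp (b n : nat) (c : program) (m : memory) (Post : memory -> Prop) :=
  bounded b m -> exists m' k,
  [/\ exec c m m' k, (k <= prog_cost n c * b ^ 2)%N, bounded b m' & Post m'].

Section Wp.
Variables b n : nat.
Hypothesis b0 : (0 < b)%N.
Implicit Types (c : program) (m : memory) (e : expr) (Post : memory -> Prop).

Lemma wp_skip m Post : Post m -> wp b n Skip m Post.
Proof.
move=> Pm mb; exists m, 1%N; split=> //; first exact: ExecSkip.
by rewrite mul1n expn_gt0 b0.
Qed.

(** The bound on the written value may appeal to the bound on the memory, as is natural when a cell
    is copied or the value is dominated by another stored number. *)
Lemma wp_write m a e1 e2 Post :
  (bounded b m -> (`|eval m e2| < 2 ^ b)%N) ->
  Post (update m a (eval m e1) (eval m e2)) ->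
  wp b n (Write a e1 e2) m Post.
Proof.
move=> e2b Pm mb; have {}e2b := e2b mb; eexists _, _; split; [exact: ExecWrite| | |exact: Pm].
- have bb : (b <= b ^ 2)%N by rewrite -[X in (X <= _)%N]expn1 leq_pexp2l.
  have H1 := eval_bits e1 b0 mb; have H2 := eval_bits e2 b0 mb.
  have C1 := eval_cost_le e1 b0 mb; have C2 := eval_cost_le e2 b0 mb.
  have := leq_mul (leqnn (expr_bits e1)) bb.
  have := leq_mul (leqnn (expr_bits e2)) bb.
  by rewrite /= !mulnDl; lia.
- by move=> a' j; rewrite /update; case: ifP.
Qed.

Lemma wp_seq m c1 c2 Post :
  wp b n c1 m (fun m' => wp b n c2 m' Post) -> wp b n (Seq c1 c2) m Post.
Proof.
move=> W mb; have [m1 [k1 [E1 K1 B1 W1]]] := W mb.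
have [m2 [k2 [E2 K2 B2 Q2]]] := W1 B1.
exists m2, (k1 + k2).+1; split=> //; first exact: ExecSeq E1 E2.
have : (0 < b ^ 2)%N by rewrite expn_gt0 b0.
rewrite /= !mulnDl; lia.
Qed.

Lemma wp_if m e c1 c2 Post :
  (0 < eval m e -> wp b n c1 m Post) -> (eval m e <= 0 -> wp b n c2 m Post) ->
  wp b n (IfPos e c1 c2) m Post.
Proof.
move=> W1 W2 mb; have C := eval_cost_le e b0 mb.
have bb : (0 < b ^ 2)%N by rewrite expn_gt0 b0.
case: (ltP 0 (eval m e)) => [gt|le].
- have [m1 [k1 [E1 K1 B1 Q1]]] := W1 gt mb.
  exists m1, (eval_cost m e + k1).+1; split=> //; first exact: ExecIfTrue.
  rewrite /= !mulnDl; lia.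
- have [m1 [k1 [E1 K1 B1 Q1]]] := W2 le mb.
  exists m1, (eval_cost m e + k1).+1; split=> //; first exact: ExecIfFalse.
  rewrite /= !mulnDl; lia.
Qed.

(** The frame property is built into the rule of consequence, which keeps untouched arrays out of
    the specifications. *)
Lemma wp_weaken m c Post Post' :
  wp b n c m Post ->
  (forall m', (forall a, a \notin writes c -> m' a = m a) -> Post m' -> Post' m') ->
  wp b n c m Post'.
Proof.
move=> W H mb; have [m1 [k1 [E1 K1 B1 Q1]]] := W mb.
by exists m1, k1; split=> //; apply: H Q1; apply: exec_frame E1.
Qed.

(** The index of the invariant bounds the remaining iterations: at index 0 a positive test must be
    contradictory, while the loop may stop at any index. *)
Lemma wp_while (Inv : nat -> memory -> Prop) k0 m e c Post :
  (k0 <= n)%N -> Inv k0 m ->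
  (forall k m', (forall a, a \notin writes c -> m' a = m a) ->
     Inv k m' -> 0 < eval m' e ->
     exists k', k = k'.+1 /\ wp b n c m' (Inv k')) ->
  (forall k m', (k <= k0)%N -> (forall a, a \notin writes c -> m' a = m a) ->
     Inv k m' -> eval m' e <= 0 -> Post m') ->
  wp b n (WhilePos e c) m Post.
Proof.
move=> kn I0 step fin mb.
have bb : (0 < b ^ 2)%N by rewrite expn_gt0 b0.
(* The time is bounded through the remaining iterations [k], so that the costs of the iterations add
   up by induction; [n] replaces [k0] only at the end. *)
suff run : forall k m', (k <= k0)%N -> Inv k m' -> bounded b m' ->
    (forall a, a \notin writes c -> m' a = m a) -> exists m2 t,
    [/\ exec (WhilePos e c) m' m2 t,
        (t <= (k * (expr_cost e + prog_cost n c + 1) + expr_cost e + 1) * b ^ 2)%N,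
        bounded b m2 & Post m2].
  have [m' [t [E K B Q]]] := run k0 m (leqnn _) I0 mb (fun _ _ => erefl).
  exists m', t; split=> //; apply: leq_trans K _ => /=.
  by rewrite leq_mul2r !leq_add2r leq_mul2r kn !orbT.
elim=> [|k IH] m' kk0 Im {}mb fr.
  have C := eval_cost_le e b0 mb.
  case: (ltP 0 (eval m' e)) => [gt|le].
    by have [k' []] := step _ _ fr Im gt.
  exists m', (eval_cost m' e).+1; split=> //; first exact: ExecWhileFalse.
    rewrite !mulnDl; lia.
  exact: fin Im le.
have C := eval_cost_le e b0 mb.
case: (ltP 0 (eval m' e)) => [gt|le]; last first.
  exists m', (eval_cost m' e).+1; split=> //; first exact: ExecWhileFalse.
    rewrite !mulnDl; lia.
  exact: fin Im le.
have [k' [[<-] W]] := step _ _ fr Im gt.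
have [m1 [k1 [E1 K1 B1 Q1]]] := W mb.
have fr1 : forall a, a \notin writes c -> m1 a = m a.
  by move=> a ha; rewrite (exec_frame E1) // fr.
have [m2 [k2 [E2 K2 B2 Q2]]] := IH m1 (ltnW kk0) Q1 B1 fr1.
exists m2, (eval_cost m' e + k1 + k2).+1; split=> //.
  exact: ExecWhileTrue E1 E2.
by move: K1 K2 C; rewrite mulSn; lia.
Qed.

End Wp.

Notation Var a := (Read a (Const 0)).
Notation "x [+] y" := (Bin Add x y) (at level 50, left associativity).
Notation "x [-] y" := (Bin Defs.Sub x y) (at level 50, left associativity).
Notation "x [*] y" := (Bin Mul x y) (at level 40, left associativity).
Notation "x [/] y" := (Bin Div x y) (at level 40, left associativity).

Definition For (v : nat) (e : expr) (c : program) : program :=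
  Seq (Write v (Const 0) (Const 0))
      (WhilePos (e [-] Var v)
         (Seq c (Write v (Const 0) (Var v [+] Const 1)))).

(** The limit [e] is evaluated anew at every test, so its value must survive all changes to the
    counter and to the arrays written by the body. *)
Lemma wp_for b n (Inv : nat -> memory -> Prop) k0 m v e c Post :
  (0 < b)%N -> (k0 <= n)%N -> (n < 2 ^ b)%N ->
  v \notin writes c ->
  (forall m', (forall a, a \notin v :: writes c -> m' a = m a) ->
     eval m' e = k0%:Z) ->
  Inv 0%N (update m v 0 0) ->
  (forall k m', (forall a, a \notin v :: writes c -> m' a = m a) ->
     (k < k0)%N -> m' v 0 = k%:Z -> Inv k m' ->
     wp b n c m' (fun m'' => Inv k.+1 (update m'' v 0 k.+1%:Z))) ->
  (forall m', (forall a, a \notin v :: writes c -> m' a = m a) ->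
     Inv k0 m' -> Post m') ->
  wp b n (For v e c) m Post.
Proof.
move=> b0 kn nb vc He I0 step fin; apply: wp_seq => //; apply: wp_write => //=.
  by rewrite expn_gt0.
have fr1 a : a \notin v :: writes c -> update m v 0 0 a = m a.
  by rewrite inE negb_or /update => /andP[/negbTE-> _].
pose Inv' k m' := [/\ (k <= k0)%N, m' v 0 = (k0 - k)%N%:Z & Inv (k0 - k)%N m'].
have fr2 m' : (forall a, a \notin writes c ++ [:: v] -> m' a = update m v 0 0 a) ->
    forall a, a \notin v :: writes c -> m' a = m a.
  move=> fr a ha; rewrite fr ?fr1 //.
  by move: ha; rewrite inE mem_cat inE orbC.
apply: (@wp_while b n b0 Inv' k0) => //.
- split=> //; first by rewrite /update !eqxx subnn.
  by rewrite subnn.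
- move=> k m' /fr2 fr [kk0 mv I] /=; rewrite He // mv.
  case: k kk0 mv I => [|k] kk0 mv I gt; first by lia.
  exists k; split=> //; apply: wp_seq => //.
  apply: wp_weaken (step _ _ fr _ mv I) _; first by lia.
  move=> m2 fr' I2; apply: wp_write => //=; rewrite fr' // mv.
    by move=> _; apply: leq_trans nb; lia.
  have -> : (k0 - k.+1)%N%:Z + 1 = (k0 - k.+1).+1%:Z by lia.
  have <- : (k0 - k)%N = (k0 - k.+1).+1 by lia.
  split; first by lia.
    by rewrite /update !eqxx.
  by have -> : (k0 - k)%N = (k0 - k.+1).+1 by lia.
- move=> k m' _ /fr2 fr [kk0 mv I] /=; rewrite He // mv => le.
  apply: fin => //; suff: (k0 - k)%N = k0 by move=> <-.
  lia.
Qed.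

(** * Circulations and complementary slackness *)

(* Order [j] is the arc from [S j] to [R j]; the last of the [N] vertices stands
   for the added maximum, whose potential is not required to be 0. *)
Section Network.

Variables (N K : nat) (R S : nat -> nat).
Hypothesis RN : forall j, (j < K)%N -> (R j < N)%N.
Hypothesis SN : forall j, (j < K)%N -> (S j < N)%N.
Hypothesis RS : forall j, (j < K)%N -> R j != S j.

Implicit Types (c cap d pi pos par : nat -> int) (j u v x y : nat).

Definition reduced c pi j : int := c j - pi (R j) + pi (S j).

Definition slackness c cap d pi := forall j, (j < K)%N ->
  [/\ 0 <= d j <= cap j, 0 < d j -> 0 <= reduced c pi j
    & d j < cap j -> reduced c pi j <= 0].

Definition excess d v : int :=
  \sum_(j < K) d j * ((R j == v)%:Z - (S j == v)%:Z).

Definition residual cap d j u v :=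
  (S j = u /\ R j = v /\ d j < cap j) \/ (R j = u /\ S j = v /\ 0 < d j).

(** Lengths are negated gains: traversed along its direction the arc has length minus its reduced
    gain, and backwards the opposite. Since the ends of an arc differ, the head [v] determines the
    direction. Slackness makes all residual lengths nonnegative. *)
Definition arc_length c pi j v : int :=
  if R j == v then - reduced c pi j else reduced c pi j.

Lemma residual_length_ge0 c cap d pi j u v :
  slackness c cap d pi -> (j < K)%N -> residual cap d j u v ->
  0 <= arc_length c pi j v.
Proof.
move=> cs jK; have [_ cs1 cs2] := cs _ jK; rewrite /arc_length.
case=> [[_ [-> /cs2]]|[_ [<- /cs1]]]; first by rewrite eqxx oppr_ge0.
by rewrite (negbTE (RS jK)).
Qed.

(** Residual arcs leaving [A] get shorter by [th], those entering get longer by [th], and all others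
    keep their length. *)
Lemma slackness_raise c cap d pi pi' (A : pred nat) th :
  slackness c cap d pi -> 0 <= th ->
  (forall v, (v < N)%N -> pi' v = if A v then pi v + th else pi v) ->
  (forall j u v, (j < K)%N -> residual cap d j u v -> A u -> ~~ A v ->
     th <= arc_length c pi j v) ->
  slackness c cap d pi'.
Proof.
move=> cs th0 Hpi' Hth j jK; have [dj cs1 cs2] := cs _ jK.
have fw := Hth j (S j) (R j) jK; have bw := Hth j (R j) (S j) jK.
rewrite /residual /arc_length eqxx (negbTE (RS jK)) in fw bw.
split=> // [d0|dc]; rewrite /reduced !Hpi' ?RN ?SN //; move: fw bw.
- have := cs1 d0; rewrite /reduced.
  case: (A (R j)); case: (A (S j)) => //=; lia.
- have := cs2 dc; rewrite /reduced.
  case: (A (R j)); case: (A (S j)) => //=; lia.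
Qed.

Lemma excess_update d d' i z v : (i < K)%N ->
  (forall j, (j < K)%N -> d' j = if j == i then d j + z else d j) ->
  excess d' v = excess d v + z * ((R i == v)%:Z - (S i == v)%:Z).
Proof.
move=> iK Hd; rewrite /excess (bigD1 (Ordinal iK)) //= [in RHS](bigD1 (Ordinal iK)) //=.
rewrite Hd // eqxx mulrDl -!addrA; congr (_ + _); rewrite addrC; congr (_ + _).
apply: eq_bigr => j /negbTE ji; rewrite Hd //.
by rewrite -[(j : nat) == i]/(j == Ordinal iK) ji.
Qed.

Lemma excess_eq d d' v : (forall j, (j < K)%N -> d' j = d j) ->
  excess d' v = excess d v.
Proof. by move=> H; apply: eq_bigr => j _; rewrite H. Qed.

Lemma slackness_eq c cap d pi c' cap' d' pi' :
  (forall j, (j < K)%N -> [/\ c' j = c j, cap' j = cap j & d' j = d j]) ->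
  (forall v, (v < N)%N -> pi' v = pi v) ->
  slackness c cap d pi -> slackness c' cap' d' pi'.
Proof.
move=> H Hp cs j jK; have [Ec Ecap Ed] := H j jK; have := cs j jK.
by rewrite /reduced Ec Ecap Ed !Hp ?RN ?SN.
Qed.

(* Vertices are numbered by [pos] in the order in which they are reached from
   [x], 0 marking those not reached; [par] gives the arc reaching a vertex. *)
Definition search_tree x c cap d pi pos par (cnt : nat) :=
  [/\ forall v, (v < N)%N -> 0 <= pos v <= cnt%:Z, pos x = 1,
      forall v, (v < N)%N -> pos v = 1 -> v = x
    & forall v, (v < N)%N -> 1 < pos v -> exists j u,
      [/\ (j < K)%N, par v = j%:Z, reduced c pi j = 0, residual cap d j u v
        & 0 < pos u < pos v]].

Lemma residual_ends cap d j u v : (j < K)%N -> residual cap d j u v ->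
  (u < N)%N /\ (v < N)%N.
Proof. by move=> jK; case=> [[<- [<- _]]|[<- [<- _]]]; rewrite RN ?SN. Qed.

(** Both ends of a tree arc are reached, so their potentials rise together and the arc stays
    tight. *)
Lemma search_tree_raise x c cap d pi pi' pos par cnt th :
  search_tree x c cap d pi pos par cnt ->
  (forall v, (v < N)%N -> pi' v = if 0 < pos v then pi v + th else pi v) ->
  search_tree x c cap d pi' pos par cnt.
Proof.
move=> [t1 t2 t3 t4] Hpi; split=> // v vN /(t4 _ vN) [j [u [jK pj rj re /andP[u0 uv]]]].
exists j, u; split=> //; last by rewrite u0.
rewrite /reduced !Hpi ?RN ?SN //; move: rj; rewrite /reduced.
have v0 := lt_trans u0 uv.
by case: re => [[-> [-> _]]|[-> [-> _]]]; rewrite u0 v0; lia.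
Qed.

(** The new vertex gets the largest number, so its parent precedes it; it had number 0 before, so it
    was neither the root nor a parent. *)
Lemma search_tree_add x c cap d pi pos par pos' par' cnt j u v :
  search_tree x c cap d pi pos par cnt -> (0 < cnt)%N ->
  (j < K)%N -> residual cap d j u v -> reduced c pi j = 0 ->
  0 < pos u -> pos v = 0 ->
  (forall w, (w < N)%N -> pos' w = if w == v then cnt.+1%:Z else pos w) ->
  (forall w, (w < N)%N -> par' w = if w == v then j%:Z else par w) ->
  (x < N)%N ->
  search_tree x c cap d pi pos' par' cnt.+1.
Proof.
move=> [t1 t2 t3 t4] c0 jK re rj u0 v0 Hpos Hpar xN.
have [uN vN] := residual_ends jK re.
have xv : x != v by apply/eqP => E; move: t2; rewrite E v0.
split.
- by move=> w wN; rewrite Hpos //; case: eqP => _; have := t1 _ wN; lia.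
- by rewrite Hpos // (negbTE xv).
- by move=> w wN; rewrite Hpos //; case: eqP => [_|_ /t3]; [lia|apply].
- move=> w wN; rewrite Hpos // Hpar //; case: eqP => [-> _|wv].
    exists j, u; split=> //; rewrite Hpos // ifN; last by apply/eqP => E; move: u0; rewrite E v0.
    by have := t1 _ uN; lia.
  case/(t4 _ wN) => [j' [u' [jK' pj' rj' re' /andP[u0' uv']]]].
  exists j', u'; split=> //; have [uN' _] := residual_ends jK' re'.
  by rewrite Hpos // ifN ?u0' //; apply/eqP => E; move: u0'; rewrite E v0.
Qed.

Definition unreached pos : nat := \sum_(v < N) (pos v == 0).

Lemma unreached_add pos pos' v z : (v < N)%N -> pos v = 0 -> 0 < z ->
  (forall w, (w < N)%N -> pos' w = if w == v then z else pos w) ->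
  unreached pos = (unreached pos').+1.
Proof.
move=> vN v0 z0 H; rewrite /unreached (bigD1 (Ordinal vN)) //= [in RHS](bigD1 (Ordinal vN)) //=.
rewrite H // eqxx v0 (gt_eqF z0) add0n eqxx add1n; congr (_.+1).
apply: eq_bigr => w /negbTE wv; rewrite H //.
by rewrite -[(w : nat) == v]/(w == Ordinal vN) wv.
Qed.

(* Pushing a unit along a tight arc [u -> v] of the tree leaves intact the
   arcs reaching the vertices that precede [v]. *)
Definition tree_below k c cap d pi pos par :=
  forall v, (v < N)%N -> 1 < pos v -> pos v <= k -> exists j u,
      [/\ (j < K)%N, par v = j%:Z, reduced c pi j = 0, residual cap d j u v
        & 0 < pos u < pos v].

(** On a tight arc slackness allows every quantity between 0 and the capacity, and residuality
    leaves room for one unit. *)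
Lemma push_unit c cap d d' pi pos par j u v :
  slackness c cap d pi -> tree_below (pos v) c cap d pi pos par ->
  (j < K)%N -> residual cap d j u v -> reduced c pi j = 0 ->
  0 < pos u < pos v ->
  (forall i, (i < K)%N -> d' i = if i == j then (if R j == v then d j + 1 else d j - 1) else d i) ->
  [/\ slackness c cap d' pi, tree_below (pos u) c cap d' pi pos par
    & forall w, excess d' w = excess d w + (w == v)%:Z - (w == u)%:Z].
Proof.
move=> cs tb jK re rj /andP[u0 uv] Hd; split.
- move=> i iK; rewrite Hd //; case: eqP => [->|_]; last exact: cs.
  have [dj cs1 cs2] := cs _ jK; rewrite rj; split=> //.
  case: re => [[_ [-> H]]|[_ [<- H]]]; first by rewrite eqxx; lia.
  by rewrite (negbTE (RS jK)); lia.
- move=> w wN w1 wu; have [|i [t [iK pi' ri rei /andP[t0 tw]]]] := tb _ wN w1.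
    by apply: ltW; apply: le_lt_trans uv.
  exists i, t; split=> //; last by rewrite t0.
  (* If [i] were [j], then [v] would be [w] or its parent [t]; but [w] is numbered at most like [u],
     which precedes [v], and [t] precedes [w]. *)
  have ij : i != j.
    apply/eqP => ij; move: rei; rewrite ij.
    by case: re => [[E1 [E2 _]]|[E1 [E2 _]]];
       case=> [[E3 [E4 _]]|[E3 [E4 _]]]; move: E1 E2 E3 E4 => *; subst; lia.
  by rewrite /residual Hd // (negbTE ij).
- move=> w; rewrite (@excess_update d d' j (if R j == v then 1 else -1) _ jK); last first.
    by move=> i iK; rewrite Hd //; case: eqP => // ->; case: ifP.
  case: re => [[<- [<- _]]|[<- [<- _]]].
    by rewrite eqxx !(eq_sym w); lia.
  by rewrite (negbTE (RS jK)) !(eq_sym w); lia.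
Qed.

(** * Optimal circulations and linear programming duality *)

Definition balanced d := forall v, (v < N)%N -> excess d v = 0.

(** Potentials cancel on a circulation: their total contribution is the sum of [pi v * excess d v],
    arranged by arcs instead of vertices. *)
Lemma sum_reduced c d pi : balanced d ->
  \sum_(j < K) c j * d j = \sum_(j < K) reduced c pi j * d j.
Proof.
move=> bal; apply/eqP; rewrite -subr_eq0 -sumrB.
have : \sum_(v < N) pi v * excess d v = 0.
  by apply: big1 => v _; rewrite bal ?mulr0.
rewrite /excess; under eq_bigr do rewrite mulr_sumr.
rewrite exchange_big /= => E; apply/eqP; rewrite -[RHS]E; apply: eq_bigr => j _.
have pick (t : nat) : (t < N)%N -> \sum_(v < N) pi v * (t == v)%:Z = pi t.
  move=> tN; rewrite (bigD1 (Ordinal tN)) //= eqxx mulr1 big1 ?addr0 // => v.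
  by rewrite eq_sym -[(t == v :> nat)]/(Ordinal tN == v) => /negbTE ->; rewrite mulr0.
under eq_bigr do rewrite mulrCA mulrBr.
by rewrite -mulr_sumr sumrB !pick ?RN ?SN // /reduced; ring.
Qed.

(** Slackness puts [d0 j] at the upper end of its interval when the reduced gain is positive and at
    0 when it is negative. *)
Lemma reduced_mul_le c cap d0 d pi j : slackness c cap d0 pi -> (j < K)%N ->
  0 <= d j <= cap j -> reduced c pi j * d j <= reduced c pi j * d0 j.
Proof.
move=> cs jK /andP[dj0 djc]; have [/andP[d00 d0c] cs1 cs2] := cs _ jK.
set r := reduced _ _ _ in cs1 cs2 *.
case: (ltgtP r 0) => [rn|rp|->]; last by rewrite !mul0r.
  have d00' : d0 j <= 0 by rewrite leNgt; apply/negP => /cs1; lia.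
  by nia.
have d0c' : cap j <= d0 j by rewrite leNgt; apply/negP => /cs2; lia.
by nia.
Qed.

Lemma weak_duality c cap d0 d pi :
  slackness c cap d0 pi -> balanced d0 -> balanced d ->
  (forall j, (j < K)%N -> 0 <= d j <= cap j) ->
  \sum_(j < K) c j * d j <= \sum_(j < K) c j * d0 j.
Proof.
move=> cs b0 b1 dc; rewrite !(@sum_reduced c _ pi) //.
by apply: ler_sum => j _; apply: reduced_mul_le cs _ (dc _ _).
Qed.

(** Each arc contributes no more to [d] than to [d0], so comparable totals force equality on every
    arc. Hence [d] and [d0] agree wherever the reduced gain is nonzero, and elsewhere only the
    capacities matter. *)
Lemma slackness_of_optimal c cap d0 d pi :
  slackness c cap d0 pi -> balanced d0 -> balanced d ->
  (forall j, (j < K)%N -> 0 <= d j <= cap j) ->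
  \sum_(j < K) c j * d0 j <= \sum_(j < K) c j * d j ->
  slackness c cap d pi.
Proof.
move=> cs b0 b1 dc; rewrite !(@sum_reduced c _ pi) // => le j jK.
have [d0j cs1 cs2] := cs _ jK; have dj := dc _ jK.
suff E : reduced c pi j * d j = reduced c pi j * d0 j.
  set r := reduced _ _ _ in cs1 cs2 E *; split=> // H.
    rewrite leNgt; apply/negP => rn.
    by have := mulfI (ltr0_neq0 rn) E; lia.
  rewrite leNgt; apply/negP => rp.
  by have := mulfI (lt0r_neq0 rp) E; lia.
apply/eqP; rewrite eq_le (reduced_mul_le cs) //=.
have D (f : nat -> int) :
    \sum_(i < K) f i = f j + \sum_(i < K | i != Ordinal jK) f i.
  by rewrite (bigD1 (Ordinal jK)).
move: le; rewrite (D (fun i => reduced c pi i * d0 i)).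
rewrite (D (fun i => reduced c pi i * d i)) /= => le.
rewrite -(lerD2r (\sum_(i < K | i != Ordinal jK) reduced c pi i * d i)).
apply: le_trans le; rewrite lerD2l.
by apply: ler_sum => i _; apply: reduced_mul_le cs _ (dc _ _).
Qed.

Lemma lexicographic_optimum c M cap d0 pi0 d1 pi1 :
  slackness c cap d0 pi0 -> balanced d0 ->
  slackness (fun j => M * c j + 1) cap d1 pi1 -> balanced d1 ->
  \sum_(j < K) cap j < M ->
  slackness c cap d1 pi0 /\
  forall d pi, slackness c cap d pi -> balanced d ->
    \sum_(j < K) d j <= \sum_(j < K) d1 j.
Proof.
move=> cs0 b0 cs1 b1 capM.
have split_sum d : \sum_(j < K) (M * c j + 1) * d j =
    M * (\sum_(j < K) c j * d j) + \sum_(j < K) d j.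
  by rewrite mulr_sumr -big_split /=; apply: eq_bigr => j _; ring.
have box c' d pi : slackness c' cap d pi -> forall j, (j < K)%N -> 0 <= d j <= cap j.
  by move=> cs j /cs[].
have max1 d : balanced d -> (forall j, (j < K)%N -> 0 <= d j <= cap j) ->
    M * (\sum_(j < K) c j * d j) + \sum_(j < K) d j <=
    M * (\sum_(j < K) c j * d1 j) + \sum_(j < K) d1 j.
  by move=> bd dc; rewrite -!split_sum; apply: weak_duality cs1 b1 bd dc.
have E1 : \sum_(j < K) c j * d0 j <= \sum_(j < K) c j * d1 j.
  have := max1 d0 b0 (box _ _ _ cs0).
  have s0 : 0 <= \sum_(j < K) d0 j.
    by apply: sumr_ge0 => j _; have /andP[] := box _ _ _ cs0 j (ltn_ord j).
  have s1 : \sum_(j < K) d1 j <= \sum_(j < K) cap j.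
    by apply: ler_sum => j _; have /andP[] := box _ _ _ cs1 j (ltn_ord j).
  have s2 : 0 <= \sum_(j < K) d1 j.
    by apply: sumr_ge0 => j _; have /andP[] := box _ _ _ cs1 j (ltn_ord j).
  (* By integrality a smaller gain is smaller by at least 1. Multiplied by [M], this loss exceeds
     the total capacity and hence the volume of [d1]. *)
  move=> le; rewrite leNgt -lezD1; apply/negP => lt.
  have M0 : 0 <= M by lia.
  by have := ler_wpM2l M0 lt; rewrite mulrDr mulr1; lia.
split; first exact: slackness_of_optimal cs0 b0 b1 (box _ _ _ cs1) E1.
move=> d pi cs bd.
(* Every competitor is itself optimal for [c], so its gain equals that of [d1], and the perturbed
   gains then compare the volumes alone. *)
have E2 := weak_duality cs bd b0 (box _ _ _ cs0).
have E3 := weak_duality cs0 b0 b1 (box _ _ _ cs1).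
have E4 := weak_duality cs0 b0 bd (box _ _ _ cs).
have E : \sum_(j < K) c j * d j = \sum_(j < K) c j * d1 j by lia.
by have := max1 d bd (box _ _ _ cs); rewrite E; lia.
Qed.

End Network.

(** * The algorithm *)

Notation aDemand := 3%N.
Notation aOffer := 4%N.
Notation aCost := 5%N.
Notation aMax := 6%N.
Notation aQty := 7%N.
Notation aCap := 8%N.
Notation aPrice := 9%N.
Notation aPos := 10%N.
Notation aPar := 11%N.
Notation vOrder := 12%N.
Notation vArc := 13%N.
Notation vVertex := 14%N.
Notation vStep := 15%N.
Notation vArg := 16%N.
Notation vNode := 17%N.
Notation vCnt := 18%N.
Notation vScale := 19%N.
Notation vWeight := 20%N.

Definition eNT : expr := Read 0 (Const 0).
Definition eNI : expr := Read 0 (Const 1).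
Definition eReduced (j : expr) : expr :=
  Read aCost j [-] Read aPrice (Read aDemand j) [+] Read aPrice (Read aOffer j).

Definition set (v : nat) (e : expr) : program := Write v (Const 0) e.

Definition relax (u v cap len : expr) : program :=
  IfPos (Read aPos u)
    (IfPos (Const 1 [-] Read aPos v)
      (IfPos cap
        (IfPos (Var vStep [-] len)
          (Seq (set vStep len) (Seq (set vArg (Var vArc)) (set vNode v)))
          Skip) Skip) Skip) Skip.

Definition scan : program :=
  For vArc eNI
    (Seq (relax (Read aOffer (Var vArc)) (Read aDemand (Var vArc))
            (Read aCap (Var vArc) [-] Read aQty (Var vArc))
            (Const 0 [-] eReduced (Var vArc)))
         (relax (Read aDemand (Var vArc)) (Read aOffer (Var vArc))
            (Read aQty (Var vArc)) (eReduced (Var vArc)))).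

Definition raise : program :=
  For vVertex (eNT [+] Const 1)
    (IfPos (Read aPos (Var vVertex))
       (Write aPrice (Var vVertex) (Read aPrice (Var vVertex) [+] Var vStep)) Skip).

(* The first candidate is order [vOrder] traversed backwards: it carries a unit, so
   it always leaves the reached set and the search cannot get stuck. *)
Definition search : program :=
  WhilePos (Const 1 [-] Read aPos (Read aOffer (Var vOrder)))
    (Seq (set vStep (eReduced (Var vOrder)))
    (Seq (set vArg (Var vOrder))
    (Seq (set vNode (Read aOffer (Var vOrder)))
    (Seq scan
    (Seq raise
    (Seq (set vCnt (Var vCnt [+] Const 1))
    (Seq (Write aPos (Var vNode) (Var vCnt))
         (Write aPar (Var vNode) (Var vArg))))))))).

Definition eArc : expr := Read aPar (Var vNode).
Definition eDiff : expr := Var vNode [-] Read aDemand (Var vArc).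

(* For integers, 0 < 1 - x * x tests x = 0. *)
Definition walk : program :=
  Seq (set vNode (Read aOffer (Var vOrder)))
    (WhilePos (Read aPos (Var vNode) [-] Const 1)
      (Seq (set vArc eArc)
        (IfPos (Const 1 [-] eDiff [*] eDiff)
          (Seq (Write aQty (Var vArc) (Read aQty (Var vArc) [+] Const 1))
               (set vNode (Read aOffer (Var vArc))))
          (Seq (Write aQty (Var vArc) (Read aQty (Var vArc) [-] Const 1))
               (set vNode (Read aDemand (Var vArc))))))).

(** Stale entries of [aPar] are harmless: they are consulted only at positions above 1, and each
    such position is assigned together with a fresh parent. *)
Definition route : program :=
  Seq (For vVertex (eNT [+] Const 1) (Write aPos (Var vVertex) (Const 0)))
  (Seq (Write aPos (Read aDemand (Var vOrder)) (Const 1))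
  (Seq (set vCnt (Const 1))
  (Seq search walk))).

(** A positive reduced gain requires saturation, so the new unit of capacity must be filled at once;
    otherwise it may stay empty. *)
Definition increment : program :=
  Seq (Write aCap (Var vOrder) (Read aCap (Var vOrder) [+] Const 1))
    (IfPos (eReduced (Var vOrder))
       (Seq (Write aQty (Var vOrder) (Read aQty (Var vOrder) [+] Const 1)) route)
       Skip).

Definition scale : program :=
  Seq (set vScale (Var vScale [/] Const 2))
  (Seq (For vArc eNI
         (Seq (Write aQty (Var vArc) (Read aQty (Var vArc) [+] Read aQty (Var vArc)))
              (Write aCap (Var vArc) (Read aCap (Var vArc) [+] Read aCap (Var vArc)))))
       (For vOrder eNI
         (IfPos (Read aMax (Var vOrder) [/] Var vScale [-] Read aCap (Var vOrder))
            increment Skip))).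

(** At a scale not below the weight, which exceeds every maximal quantity, all rounded capacities
    vanish, and zero quantities with zero prices satisfy slackness for any gain. *)
Definition solve : program :=
  Seq (For vOrder eNI (Seq (Write aQty (Var vOrder) (Const 0)) (Write aCap (Var vOrder) (Const 0))))
  (Seq (For vVertex (eNT [+] Const 1) (Write aPrice (Var vVertex) (Const 0)))
  (Seq (set vScale (Const 1))
  (Seq (WhilePos (Var vWeight [-] Var vScale) (set vScale (Var vScale [+] Var vScale)))
       (WhilePos (Var vScale [-] Const 1) scale)))).

(** * Programs for input and output *)

Definition eQBase : expr := Const 2 [+] eNT [+] eNI.
Definition eEntry : expr := Var vOrder [*] eNT [+] Var vVertex.

(** The matrix [Q] has no column for the added maximum. Both ends are preset to it, with number
    [nT], and a nonzero entry overwrites the preset. *)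
Definition read_order : program :=
  For vVertex eNT
    (Seq (IfPos (Read 0 (eQBase [+] eEntry)) (Write aDemand (Var vOrder) (Var vVertex)) Skip)
    (Seq (IfPos (Const 0 [-] Read 0 (eQBase [+] eEntry))
            (Write aOffer (Var vOrder) (Var vVertex)) Skip)
         (Write aCost (Var vOrder)
            (Read aCost (Var vOrder) [+]
             Read 0 (eQBase [+] eNI [*] eNT [+] eEntry) [*]
             Read 0 (eQBase [+] eEntry))))).

Definition read_input : program :=
  Seq (set vWeight (Const 1))
    (For vOrder eNI
      (Seq (Write aDemand (Var vOrder) eNT)
      (Seq (Write aOffer (Var vOrder) eNT)
      (Seq (Write aCost (Var vOrder) (Const 0))
      (Seq (Write aMax (Var vOrder)
              (Read 0 (eQBase [+] Const 2 [*] (eNI [*] eNT) [+] Var vOrder)))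
      (Seq (set vWeight (Var vWeight [+] Read aMax (Var vOrder)))
           read_order)))))).

(** Reduced gains depend only on differences of potentials; the shift gives the added maximum
    potential 0. *)
Definition write_prices : program :=
  For vVertex eNT
    (Write 2 (Var vVertex) (Read aPrice (Var vVertex) [-] Read aPrice eNT)).

Definition perturb_costs : program :=
  For vOrder eNI
    (Write aCost (Var vOrder) (Var vWeight [*] Read aCost (Var vOrder) [+] Const 1)).

Definition write_quantities : program :=
  For vOrder eNI (Write 1 (Var vOrder) (Read aQty (Var vOrder))).

Definition auction_solver : program :=
  Seq read_input (Seq solve (Seq write_prices
    (Seq perturb_costs (Seq solve write_quantities)))).

Arguments update : simpl never.

(** * Specifications of the subprograms *)

Notation arr m a := (fun j : nat => (m : memory) a j%:Z).

Lemma ltnS_eqVlt u k : (u < k.+1)%N = (u == k) || (u < k)%N.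
Proof. by rewrite ltnS leq_eqVlt. Qed.

Section Spec.

Variables (b n nt K : nat) (R S : nat -> nat) (U : nat -> int).
Notation N := nt.+1.
Hypothesis b0 : (0 < b)%N.
Hypothesis nb : (n < 2 ^ b)%N.
Hypothesis Nn : (N <= n)%N.
Hypothesis Kn : (K <= n)%N.
Hypothesis RN : forall j, (j < K)%N -> (R j < N)%N.
Hypothesis SN : forall j, (j < K)%N -> (S j < N)%N.
Hypothesis RS : forall j, (j < K)%N -> R j != S j.

Notation wp := (wp b n).
Implicit Types m : memory.

Definition env (m : memory) :=
  [/\ m 0%N 0 = nt%:Z, m 0%N 1 = K%:Z,
      forall j, (j < K)%N -> m aDemand j%:Z = (R j)%:Z,
      forall j, (j < K)%N -> m aOffer j%:Z = (S j)%:Z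
    & forall j, (j < K)%N -> m aMax j%:Z = U j].

Lemma env_frame m m' : env m ->
  (forall a, a \in [:: 0%N; aDemand; aOffer; aMax] -> m' a = m a) -> env m'.
Proof. by move=> E H; rewrite /env !H. Qed.

Lemma small_lt k : (k <= n)%N -> (`|k%:Z| < 2 ^ b)%N.
Proof. by move=> kn; apply: leq_ltn_trans nb. Qed.

(* [P] selects the arcs examined so far; a position <= 0 means not reached. *)
Definition best_arc (m m' : memory) (P : nat -> nat -> nat -> Prop) :=
  (exists a u v, [/\ (a < K)%N, m' vArg 0 = a%:Z, m' vNode 0 = v%:Z,
     residual R S (arr m aCap) (arr m aQty) a u v &
     [/\ 0 < m aPos u%:Z, m aPos v%:Z <= 0 &
     m' vStep 0 = arc_length R S (arr m aCost) (arr m aPrice) a v]]) /\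
  (forall j u v, (j < K)%N -> P j u v ->
     residual R S (arr m aCap) (arr m aQty) j u v ->
     0 < m aPos u%:Z -> m aPos v%:Z <= 0 ->
     m' vStep 0 <= arc_length R S (arr m aCost) (arr m aPrice) j v).

(** The head [ev] is evaluated once more after [vStep] and [vArg] have been written, hence the
    hypothesis on the twice updated memory. *)
Lemma relax_spec m m' (eu ev ecap elen : expr) j u v (P : nat -> nat -> nat -> Prop) :
  (j < K)%N -> m' vArc 0 = j%:Z -> m' aPos = m aPos ->
  eval m' eu = u%:Z -> eval m' ev = v%:Z -> (v <= n)%N ->
  (forall x y, let m1 := update (update m' vStep 0 x) vArg 0 y in eval m1 ev = v%:Z) ->
  (0 < eval m' ecap <-> residual R S (arr m aCap) (arr m aQty) j u v) ->
  eval m' elen = arc_length R S (arr m aCost) (arr m aPrice) j v ->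
  (`|arc_length R S (arr m aCost) (arr m aPrice) j v| < 2 ^ b)%N ->
  best_arc m m' P ->
  wp (relax eu ev ecap elen) m' (fun m'' =>
     best_arc m m'' (fun j' u' v' => P j' u' v' \/ [/\ j' = j, u' = u & v' = v])).
Proof.
move=> jK Ej Epos Eu Ev vn Ev' Hcap Hlen len_b [[a [x [y [aK Ha Hn Hr [Hx Hy Ht]]]]] best].
(* Common to the four failing tests: each of them refutes one conjunct and leaves the recorded arc
   in place. *)
have skip : ~ [/\ 0 < m aPos u%:Z, m aPos v%:Z <= 0,
    residual R S (arr m aCap) (arr m aQty) j u v &
    arc_length R S (arr m aCost) (arr m aPrice) j v < m' vStep 0] ->
  best_arc m m' (fun j' u' v' => P j' u' v' \/ [/\ j' = j, u' = u & v' = v]).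
  move=> H; split; first by exists a, x, y.
  move=> j' u' v' jK' [|[-> -> ->]]; first exact: best.
  move=> r' u0 v0; rewrite leNgt; apply/negP => lt; apply: H; split=> //.
apply: wp_if => //=; rewrite Eu Epos => u0; last first.
  by apply: wp_skip => //; apply: skip => -[]; lia.
apply: wp_if => //=; rewrite Ev Epos => v0; last first.
  by apply: wp_skip => //; apply: skip => -[]; lia.
apply: wp_if => //= [/Hcap res|Hc]; last first.
  by apply: wp_skip => //; apply: skip => -[_ _ /Hcap]; lia.
apply: wp_if => //=; rewrite Hlen => lt; last first.
  by apply: wp_skip => //; apply: skip => -[_ _ _]; lia.
apply: wp_seq => //; apply: wp_write => //=; first by rewrite Hlen.
apply: wp_seq => //; apply: wp_write => //=.
apply: wp_write => //=; rewrite Ev'; first by move=> _; apply: small_lt.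
split.
  by exists j, u, v; split=> //; rewrite /update /= ?Ej // Hlen; split=> //; lia.
move=> j' u' v' jK' [H|[-> -> ->]] r' u0' v0'; rewrite /update /= Hlen //.
by apply: le_trans (best _ _ _ jK' H r' u0' v0'); lia.
Qed.

Lemma scan_spec m : env m ->
  (forall j v, (j < K)%N ->
     (`|arc_length R S (arr m aCost) (arr m aPrice) j v| < 2 ^ b)%N) ->
  best_arc m m (fun _ _ _ => False) ->
  wp scan m (fun m' => best_arc m m' (fun _ _ _ => True)).
Proof.
move=> E Hb B0.
pose Inv (k : nat) m' := best_arc m m' (fun j _ _ => (j < k)%N).
apply: (@wp_for b n Inv K) => //.
- by move=> m' fr /=; rewrite fr //; case: E.
- split; last by [].
  by case: B0 => -[a [u [v H]]] _; exists a, u, v; rewrite /update /=.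
- move=> k m' fr kK mk I; have [_ _ ER ES _] := E.
  have eR : eval m' (Read aDemand (Var vArc)) = (R k)%:Z by rewrite /= mk fr // ER.
  have eS : eval m' (Read aOffer (Var vArc)) = (S k)%:Z by rewrite /= mk fr // ES.
  have Rn := leq_trans (RN kK) Nn; have Sn := leq_trans (SN kK) Nn.
  apply: wp_seq => //.
  apply: (wp_weaken (@relax_spec m m' _ _ _ _ k (S k) (R k) _ kK mk _ _ _ _ _ _ _ _ I)).
  + by rewrite fr.
  + exact: eS.
  + exact: eR.
  + exact: ltnW.
  + by move=> x y /=; rewrite /update /= mk fr // ER.
  + rewrite /= mk !fr // /residual; split; last by case=> [[_ [_]]|[H]]; [lia|have := RS kK; rewrite H eqxx].
    by move=> H; left; do !split; lia.
  + by rewrite /= /arc_length /reduced eqxx mk !fr // ER // ES //; lia.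
  + exact: Hb.
  move=> m2 fr2 I2.
  have fr' a : a \notin vArc :: writes (relax (Read aOffer (Var vArc)) (Read aDemand (Var vArc))
            (Read aCap (Var vArc) [-] Read aQty (Var vArc))
            (Const 0 [-] eReduced (Var vArc))) -> m2 a = m a.
    move=> ha; rewrite fr2; last by move: ha; rewrite inE negb_or => /andP[].
    by apply: fr; move: ha; rewrite !inE;
      case: (a == vArc); case: (a == vStep); case: (a == vArg); case: (a == vNode).
  have mk2 : m2 vArc 0 = k by rewrite fr2.
  have eR2 : eval m2 (Read aDemand (Var vArc)) = (R k)%:Z by rewrite /= mk2 fr' // ER.
  have eS2 : eval m2 (Read aOffer (Var vArc)) = (S k)%:Z by rewrite /= mk2 fr' // ES.
  apply: (wp_weaken (@relax_spec m m2 _ _ _ _ k (R k) (S k) _ kK mk2 _ _ _ _ _ _ _ _ I2)).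
  + by rewrite fr'.
  + exact: eR2.
  + exact: eS2.
  + exact: ltnW.
  + by move=> x y /=; rewrite /update /= mk2 fr' // ES.
  + rewrite /= mk2 !fr' // /residual; split; last by case=> [[H]|[_ [_]]]; [have := RS kK; rewrite H eqxx|].
    by move=> H; right; do !split; lia.
  + by rewrite /= /arc_length /reduced (negbTE (RS kK)) mk2 !fr' // ER // ES //; lia.
  + exact: Hb.
  move=> m3 fr3 [[a [u [v Hex]]] Hbest]; split.
    by exists a, u, v; rewrite /update /=.
  move=> j u' v' jK; rewrite ltnS leq_eqVlt => /orP[/eqP->|jk] res; rewrite /update /=.
    apply: Hbest => //; case: (res) => [[-> [-> _]]|[-> [-> _]]]; first by left; right.
    by right.
  by apply: Hbest => //; left; left.
- by move=> m' fr [H1 H2]; split=> // j u v jK _; apply: H2.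
Qed.

Lemma raise_spec m : env m ->
  (forall v, (v < N)%N -> (`|(m aPrice v%:Z + m vStep 0)%R| < 2 ^ b)%N) ->
  wp raise m (fun m' => forall v, (v < N)%N ->
    m' aPrice v%:Z = if 0 < m aPos v%:Z then m aPrice v%:Z + m vStep 0 else m aPrice v%:Z).
Proof.
move=> E Hb.
pose Inv (k : nat) m' := forall v, (v < N)%N ->
    m' aPrice v%:Z = if (0 < m aPos v%:Z) && (v < k)%N then m aPrice v%:Z + m vStep 0 else m aPrice v%:Z.
apply: (@wp_for b n Inv N) => //.
- by move=> m' fr /=; rewrite fr //; case: E => -> *; lia.
- by move=> v vN; rewrite /update /= andbF.
- move=> k m' fr kN mk I; apply: wp_if => //=; rewrite mk !fr // => H.
    apply: wp_write => //=; rewrite mk ?I // ltnn andbF !fr //; first by move=> _; apply: Hb.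
    move=> v vN; rewrite /update /= I // eqz_nat ltnS_eqVlt.
    by case: eqP => [->|_] //=; rewrite H.
  apply: wp_skip => // v vN; rewrite /update /= I //= ltnS_eqVlt.
  by case: eqP => [->|_] //=; rewrite ltNge H /=.
- by move=> m' fr I v vN; rewrite I // vN andbT.
Qed.

Lemma arc_length_bound c pi j v (W X : nat) : (j < K)%N ->
  (`|c j| <= W)%N -> (forall u, (u < N)%N -> (`|pi u| <= X)%N) ->
  (`|arc_length R S c pi j v| <= W + X + X)%N.
Proof.
move=> jK cW piX; rewrite /arc_length /reduced.
by have := piX _ (RN jK); have := piX _ (SN jK); case: ifP => _; lia.
Qed.

Lemma unreached_gt0 pos v : (v < N)%N -> pos v = 0 -> (0 < unreached N pos)%N.
Proof. by move=> vN v0; rewrite /unreached (bigD1 (Ordinal vN)) //= v0 eqxx. Qed.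

(* A round raises potentials by at most a reduced gain, so it multiplies their
   bound by at most 4.  The bit lengths thus grow linearly with the number of
   rounds, which makes sharper bounds on potentials unnecessary. *)
Lemma search_spec m i (W e : nat) : env m -> (i < K)%N -> m vOrder 0 = i%:Z ->
  slackness K R S (arr m aCost) (arr m aCap) (arr m aQty) (arr m aPrice) ->
  0 < m aQty i%:Z ->
  search_tree N K R S (R i) (arr m aCost) (arr m aCap) (arr m aQty) (arr m aPrice)
    (arr m aPos) (arr m aPar) 1 ->
  (unreached N (arr m aPos)).+1 = N -> m vCnt 0 = 1 ->
  (forall j, (j < K)%N -> (`|m aCost j%:Z| <= W)%N) ->
  (forall v, (v < N)%N -> (`|m aPrice v%:Z| <= W * 4 ^ e)%N) ->
  (W * 4 ^ (e + N) < 2 ^ b)%N ->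
  wp search m (fun m' =>
    [/\ slackness K R S (arr m aCost) (arr m aCap) (arr m aQty) (arr m' aPrice),
        exists2 cnt, (cnt <= N)%N & search_tree N K R S (R i) (arr m aCost)
          (arr m aCap) (arr m aQty) (arr m' aPrice) (arr m' aPos) (arr m' aPar) cnt,
        0 < m' aPos (S i)%:Z
      & forall v, (v < N)%N -> (`|m' aPrice v%:Z| <= W * 4 ^ (e + N))%N]).
Proof.
move=> E iK mi cs0 Di tree0 un0 cnt0 costW P0 Wb; have [_ _ ER ES _] := E.
(* The variant [k] counts the unreached vertices. Every round reaches one more, and the exponent of
   the price bound grows along with [cnt]. *)
pose Inv k m' := exists cnt, [/\ m' vCnt 0 = cnt%:Z, (0 < cnt)%N,
   unreached N (arr m' aPos) = k, (k + cnt)%N = N &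
   [/\ slackness K R S (arr m aCost) (arr m aCap) (arr m aQty) (arr m' aPrice),
       search_tree N K R S (R i) (arr m aCost)
          (arr m aCap) (arr m aQty) (arr m' aPrice) (arr m' aPos) (arr m' aPar) cnt
     & forall v, (v < N)%N -> (`|m' aPrice v%:Z| <= W * 4 ^ (e + cnt))%N]].
have RiN := RN iK; have SiN := SN iK.
apply: (@wp_while b n b0 Inv nt).
- exact: ltnW.
- exists 1%N; split=> //; [by case: un0| by lia|split=> //].
  move=> v vN; apply: leq_trans (P0 _ vN) _.
  by rewrite leq_mul2l leq_exp2l // leq_addr orbT.
- move=> k m' fr [cnt [mc c0 un kc [cs tree bd]]] /=.
  rewrite (fr vOrder) // (fr aOffer) // mi ES // => y0; have [t1 t2 t3 t4] := tree.
  have {}y0 : m' aPos (S i)%:Z = 0 by have := t1 _ SiN; lia.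
  have := @unreached_gt0 (arr m' aPos) _ SiN y0.
  case: k un kc => [|k] un kc; first by rewrite un.
  move=> _; exists k; split=> //.
  have cntN : (cnt < N)%N by lia.
  have X1 : (W * 4 ^ (e + cnt) * 4 < 2 ^ b)%N.
    apply: leq_ltn_trans Wb; rewrite -mulnA -expnSr leq_mul2l leq_exp2l //.
    by rewrite -addnS leq_add2l cntN orbT.
  have X2 : (W <= W * 4 ^ (e + cnt))%N by rewrite leq_pmulr // expn_gt0.
  (* With X the current price bound and [W <= X], a length is at most [W + 2 * X <= 3 * X]; adding
     it to a price gives at most [4 * X], the source of the base 4. *)
  have lenb j v : (j < K)%N ->
     (`|arc_length R S (arr m aCost) (arr m' aPrice) j v| <= W * 4 ^ (e + cnt) * 3)%N.
    by move=> jK; have := @arc_length_bound (arr m aCost) (arr m' aPrice) j v _ _ jK (costW _ jK) bd; lia.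
  have lenS : arc_length R S (arr m aCost) (arr m' aPrice) i (S i) =
      reduced R S (arr m aCost) (arr m' aPrice) i.
    by rewrite /arc_length (negbTE (RS iK)).
  have redE : eval m' (eReduced (Var vOrder)) =
      reduced R S (arr m aCost) (arr m' aPrice) i.
    by rewrite /eReduced /= !(fr vOrder) // mi !(fr aCost, fr aDemand, fr aOffer) // ER // ES.
  apply: wp_seq => //; apply: wp_write => //.
    by move=> _; rewrite redE; have := lenb i (S i) iK; rewrite lenS; lia.
  rewrite redE; apply: wp_seq => //; apply: wp_write => //=.
  apply: wp_seq => //; apply: wp_write => //=.
  set m1 := update _ vNode _ _.
  have E1 : env m1.
    apply: (env_frame E) => a; rewrite !inE => /or4P[] /eqP-> ;
      rewrite /m1 /update /= fr //.
  have m1P : m1 aPrice = m' aPrice by [].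
  have m1pos : m1 aPos = m' aPos by [].
  have m1D : m1 aQty = m aQty by rewrite -(fr aQty).
  have m1C : m1 aCap = m aCap by rewrite -(fr aCap).
  have m1cost : m1 aCost = m aCost by rewrite -(fr aCost).
  apply: wp_seq => //.
  have best0 : best_arc m1 m1 (fun _ _ _ => False).
    split=> //; exists i, (R i), (S i); rewrite m1P m1pos m1D m1C m1cost t2 y0.
    rewrite lenS /m1 /update /= fr // mi fr // ES //; split=> //.
    by right.
  apply: (wp_weaken (scan_spec E1 _ best0)).
    by move=> j v jK; rewrite m1P m1cost; have := lenb j v jK; lia.
  move=> m2 fr2 [[a [u [v [aK Ha Hv res [u0 v0 th]]]]] best].
  rewrite m1D m1C m1P m1cost m1pos in res u0 v0 th best.
  have [uN vN] := residual_ends RN SN aK res.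
  have {}v0 : m' aPos v%:Z = 0 by have := t1 _ vN; lia.
  have E2 : env m2.
    by apply: (env_frame E1) => b1; rewrite !inE => /or4P[] /eqP->; apply: fr2.
  have thge := residual_length_ge0 RS cs aK res.
  have thle := lenb a v aK; rewrite -th in thge thle.
  apply: wp_seq => //; apply: (wp_weaken (raise_spec E2 _)).
    by move=> w wN; rewrite fr2 // m1P; have := bd _ wN; lia.
  move=> m3 fr3 HP; have m2pos : m2 aPos = m' aPos by rewrite fr2.
  have m2P : m2 aPrice = m' aPrice by rewrite fr2.
  rewrite m2pos m2P in HP.
  have mc3 : m3 vCnt 0 = cnt by rewrite fr3 // fr2.
  apply: wp_seq => //; apply: wp_write => //=.
    by move=> _; rewrite mc3; apply: leq_ltn_trans nb; lia.
  rewrite mc3; apply: wp_seq => //; apply: wp_write => //=.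
    by move=> _; apply: leq_ltn_trans nb; lia.
  apply: wp_write => //=.
  set m4 := update (update _ aPos _ _) aPar _ _.
  have m4nd : update m3 vCnt 0 (cnt%:Z + 1) vNode 0 = v%:Z.
    by rewrite /update /= fr3.
  have m4arg : update m3 vCnt 0 (cnt%:Z + 1) vArg 0 = a%:Z.
    by rewrite /update /= fr3.
  have Hpos w : m4 aPos w%:Z = if w == v then cnt.+1%:Z else m' aPos w%:Z.
    rewrite /m4 m4nd /update /= eqz_nat fr3 // fr2 //.
    by case: ifP => // _; lia.
  have Hpar w : m4 aPar w%:Z = if w == v then a%:Z else m' aPar w%:Z.
    by rewrite /m4 m4nd /update /= !fr3 // Hv Ha eqz_nat fr2.
  have Hcnt : m4 vCnt 0 = cnt%:Z + 1 by [].
  have m4P : m4 aPrice = m3 aPrice by [].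
  exists cnt.+1; split.
  + by rewrite Hcnt; lia.
  + by [].
  + apply/eqP; rewrite -eqSS -un; apply/eqP/esym.
    by apply: (unreached_add vN v0 _ (fun w _ => Hpos w)).
  + by lia.
  have HP' w : (w < N)%N -> m3 aPrice w%:Z =
      if 0 < m' aPos w%:Z then m' aPrice w%:Z + m2 vStep 0 else m' aPrice w%:Z by exact: HP.
  rewrite m4P; split.
  + apply: (slackness_raise RN SN RS (A := fun w => 0 < m' aPos w%:Z) cs thge HP').
    move=> j p q jK r pp qq; apply: (best _ _ _ jK I r pp).
    by rewrite leNgt; exact: qq.
  + apply: (search_tree_add RN SN _ c0 aK res _ u0 v0 (fun w _ => Hpos w) (fun w _ => Hpar w) RiN).
      exact: (search_tree_raise RN SN tree HP').
    (* The rise equals the length of the recorded arc and only its tail is raised, so the arc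
       becomes tight. *)
    rewrite /reduced !HP' ?RN ?SN //; move: th u0 v0; rewrite /arc_length /reduced.
    case: res => [[<- [<- _]]|[<- [<- _]]] th u0 v0; rewrite u0 v0 ltxx.
      by move: th; rewrite eqxx; lia.
    by move: th; rewrite (negbTE (RS aK)); lia.
  + move=> w wN; rewrite addnS expnSr mulnA /update /= HP' //.
    by have := bd _ wN; case: ifP => _; lia.
- move=> k m' _ fr [cnt [mc c0 un kc [cs tree bd]]] /=.
  rewrite (fr vOrder) // (fr aOffer) // mi ES // => y0; split=> //; last first.
  + move=> v vN; apply: leq_trans (bd _ vN) _.
    by rewrite leq_mul2l leq_exp2l // leq_add2l; apply/orP; right; lia.
  + by lia.
  + by exists cnt => //; lia.
Qed.

Lemma walk_spec m i cnt : env m -> (i < K)%N -> m vOrder 0 = i%:Z ->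
  slackness K R S (arr m aCost) (arr m aCap) (arr m aQty) (arr m aPrice) ->
  (cnt <= N)%N ->
  search_tree N K R S (R i) (arr m aCost) (arr m aCap) (arr m aQty) (arr m aPrice)
    (arr m aPos) (arr m aPar) cnt ->
  0 < m aPos (S i)%:Z ->
  (forall w, (w < N)%N ->
     excess K R S (arr m aQty) w = (w == R i)%:Z - (w == S i)%:Z) ->
  wp walk m (fun m' =>
    slackness K R S (arr m aCost) (arr m aCap) (arr m' aQty) (arr m aPrice) /\
    balanced N K R S (arr m' aQty)).
Proof.
move=> E iK mi cs0 cN [t1 t2 t3 t4] y0 ex0; have [_ _ ER ES _] := E.
have [RiN SiN] := (RN iK, SN iK).
(* The surplus unit stays at [R i] while the deficit travels from [S i] up the tree; they cancel
   when it arrives at the root [R i]. *)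
pose Inv k m' := exists u, [/\ m' vNode 0 = u%:Z, (u < N)%N,
   0 < m aPos u%:Z <= k.+1%:Z &
   [/\ slackness K R S (arr m aCost) (arr m aCap) (arr m' aQty) (arr m aPrice),
       tree_below N K R S (m aPos u%:Z) (arr m aCost) (arr m aCap) (arr m' aQty)
         (arr m aPrice) (arr m aPos) (arr m aPar)
     & forall w, (w < N)%N ->
     excess K R S (arr m' aQty) w = (w == R i)%:Z - (w == u)%:Z]].
apply: wp_seq => //; apply: wp_write => //=; rewrite mi ES //.
set m0 := update m vNode 0 _.
apply: (@wp_while b n b0 Inv nt); first exact: ltnW.
- exists (S i); split=> //; first by rewrite y0; have := t1 _ SiN; lia.
  by split=> // v vN v1 _; apply: t4.
- move=> k m' fr [u [mu uN /andP[u0 uk] [cs tb ex]]] /=.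
  rewrite (fr aPos) // mu => u1.
  case: k uk => [|k] uk; first by move: u1; rewrite /m0 /update /=; lia.
  exists k; split=> //.
  have {}u1 : 1 < m aPos u%:Z by move: u1; rewrite /m0 /update /=; lia.
  have [j [v [jK pj rj re /andP[v0 vu]]]] := tb _ uN u1 (lexx _).
  have [vN _] := residual_ends RN SN jK re.
  have mpar : m' aPar = m aPar by rewrite (fr aPar).
  have mR : m' aDemand = m aDemand by rewrite (fr aDemand).
  have mS : m' aOffer = m aOffer by rewrite (fr aOffer).
  have push d' := @push_unit N K R S RS _ _ _ d' _ _ _ _ _ _ cs tb jK re rj (introT andP (conj v0 vu)).
  have [/andP[dj0 djc] _ _] := cs _ jK.
  apply: wp_seq => //; apply: wp_write => //=; rewrite mu mpar pj.
  have capb : bounded b (update m' vArc 0 j%:Z) -> (`|m aCap j%:Z| < 2 ^ b)%N.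
    by move=> bd; have := bd aCap j%:Z; rewrite /update /= (fr aCap).
  have Hnd : update m' vArc 0 j%:Z vNode 0 - update m' vArc 0 j%:Z aDemand (update m' vArc 0 j%:Z vArc 0)
     = u%:Z - (R j)%:Z by rewrite /update /= mu mR ER.
  apply: wp_if => //=; rewrite Hnd => test.
  + have Ru : R j = u by nia.
    have jS : v = S j.
      by case: re => [[<- _]|[Rv [Su _]]] //; move: (RS jK); rewrite Ru -Su; move: Rv vu; rewrite Ru => ->; rewrite ltxx.
    have res : arr m' aQty j < m aCap j%:Z.
      by case: re => [[_ [_]]|[Rv _]] //; move: vu; rewrite -Rv Ru ltxx.
    apply: wp_seq => //; apply: wp_write => //=.
      by move=> /capb; rewrite /update /= in res *; lia.
    apply: wp_write => //=.
    set m4 := update _ _ _ _.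
    have [] := push (arr m4 aQty).
      by move=> l lK; rewrite /m4 /update /= eqz_nat Ru eqxx.
    move=> cs' tb' ex'; exists v; split=> //.
    + by rewrite /m4 /update /= mS ES // jS.
    + by lia.
    + by split=> // w wN; rewrite ex' ex //; lia.
  + have Ru : R j != u by apply/eqP => Ru; move: test; rewrite Ru; lia.
    have jS : v = R j by case: re => [[_ [Rv _]]|[<- _]] //; rewrite Rv eqxx in Ru.
    have res : 0 < arr m' aQty j.
      by case: re => [[_ [Rv _]]|[_ [_]]] //; rewrite Rv eqxx in Ru.
    apply: wp_seq => //; apply: wp_write => //=.
      by move=> /capb; rewrite /update /= in res *; lia.
    apply: wp_write => //=.
    set m4 := update _ _ _ _.
    have [] := push (arr m4 aQty).
      by move=> l lK; rewrite /m4 /update /= eqz_nat (negbTE Ru).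
    move=> cs' tb' ex'; exists v; split=> //.
    + by rewrite /m4 /update /= mR ER // jS.
    + by lia.
    + by split=> // w wN; rewrite ex' ex //; lia.
- move=> k m' _ fr [u [mu uN /andP[u0 uk] [cs tb ex]]] /=.
  rewrite (fr aPos) // mu => u1; split=> // w wN; rewrite ex //.
  have -> : u = R i by apply: t3 => //; move: u1; rewrite /m0 /update /=; lia.
  by rewrite subrr.
Qed.

Lemma route_spec m i (W e : nat) : env m -> (i < K)%N -> m vOrder 0 = i%:Z ->
  slackness K R S (arr m aCost) (arr m aCap) (arr m aQty) (arr m aPrice) ->
  0 < m aQty i%:Z ->
  (forall w, (w < N)%N ->
     excess K R S (arr m aQty) w = (w == R i)%:Z - (w == S i)%:Z) ->
  (forall j, (j < K)%N -> (`|m aCost j%:Z| <= W)%N) ->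
  (forall v, (v < N)%N -> (`|m aPrice v%:Z| <= W * 4 ^ e)%N) ->
  (W * 4 ^ (e + N) < 2 ^ b)%N ->
  wp route m (fun m' =>
    [/\ slackness K R S (arr m aCost) (arr m aCap) (arr m' aQty) (arr m' aPrice),
        balanced N K R S (arr m' aQty)
      & forall v, (v < N)%N -> (`|m' aPrice v%:Z| <= W * 4 ^ (e + N))%N]).
Proof.
move=> E iK mi cs Di ex costW P0 Wb; have [En _ ER ES _] := E.
pose Inv k m' := forall v, (v < k)%N -> m' aPos v%:Z = 0.
apply: wp_seq => //.
apply: (wp_weaken (@wp_for b n Inv N m _ _ _ (Inv N) b0 Nn nb _ _ _ _ _)) => //.
- by move=> m' fr /=; rewrite fr // En; lia.
- move=> k m' fr kN mk I; apply: wp_write => //=; first by rewrite expn_gt0.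
  rewrite mk => v; rewrite ltnS_eqVlt /update /= eqz_nat.
  by case: eqP => //= _; apply: I.
move=> m1 fr1 pos0.
have iR : m1 aDemand (m1 vOrder 0) = (R i)%:Z by rewrite (fr1 vOrder) // mi (fr1 aDemand) // ER.
apply: wp_seq => //; apply: wp_write => //=.
  by move=> _; apply: leq_ltn_trans nb; lia.
rewrite iR; apply: wp_seq => //; apply: wp_write => //=.
  by move=> _; apply: leq_ltn_trans nb; lia.
set m2 := update _ vCnt _ _.
have Hpos v : m2 aPos v%:Z = if v == R i then 1 else m1 aPos v%:Z.
  by rewrite /m2 /update /= eqz_nat.
have fr2 a : a \notin [:: aPos; vCnt; vVertex] -> m2 a = m a.
  move=> ha; rewrite -(fr1 a); last first.
    by move: ha; rewrite !inE; case: (a == aPos); case: (a == vVertex); rewrite ?orbT.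
  move: ha; rewrite !inE /m2 /update.
  by case: (a == aPos) => //; case: (a == vCnt).
have E2 : env m2.
  by apply: (env_frame E) => a; rewrite !inE => /or4P[] /eqP->; rewrite fr2.
have tree : search_tree N K R S (R i) (arr m2 aCost) (arr m2 aCap) (arr m2 aQty)
   (arr m2 aPrice) (arr m2 aPos) (arr m2 aPar) 1.
  split=> [v vN||v vN|v vN]; rewrite Hpos ?eqxx //.
  - by case: eqP => // _; rewrite pos0.
  - by case: eqP => // _; rewrite pos0.
  - by case: eqP => [_|_]; rewrite ?pos0 // ltxx.
have un : (unreached N (arr m2 aPos)).+1 = N.
  rewrite -(@unreached_add N (fun _ => 0) _ (R i) 1 (RN iK)) //.
    by rewrite /unreached (eq_bigr (fun _ => 1%N)) // sum1_card card_ord.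
  by move=> w wN; rewrite Hpos pos0.
apply: wp_seq => //.
apply: (wp_weaken (@search_spec m2 i W e E2 iK _ _ _ tree un _ _ _ Wb)).
- by rewrite fr2.
- by rewrite !fr2.
- by rewrite fr2.
- by [].
- by rewrite fr2.
- by rewrite fr2.
move=> m3 fr3; rewrite !fr2 // => -[cs3 [cnt cntN tree3] y3 P3].
have E3 : env m3.
  by apply: (env_frame E2) => a; rewrite !inE => /or4P[] /eqP->; rewrite fr3.
have fr a : a \notin [:: aPos; vCnt; vVertex] ++ writes search -> m3 a = m a.
  by rewrite mem_cat negb_or => /andP[h1 h2]; rewrite fr3 // fr2.
apply: (wp_weaken (@walk_spec m3 i cnt E3 iK _ _ cntN _ y3 _)).
- by rewrite fr.
- by rewrite (fr aCost) // (fr aCap) // (fr aQty).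
- by rewrite (fr aCost) // (fr aCap) // (fr aQty).
- by move=> w wN; rewrite (fr aQty) // ex.
move=> m4 fr4 [cs4 bal4]; split=> //.
  by rewrite (fr4 aPrice) // -(fr aCap) // -(fr aCost).
by rewrite (fr4 aPrice).
Qed.

Lemma weight_mono (W e e' : nat) :
  (e <= e')%N -> (W * 4 ^ e <= W * 4 ^ e')%N.
Proof. by move=> le; rewrite leq_mul2l leq_exp2l // le orbT. Qed.

Lemma increment_spec m i (W e : nat) : env m -> (i < K)%N -> m vOrder 0 = i%:Z ->
  slackness K R S (arr m aCost) (arr m aCap) (arr m aQty) (arr m aPrice) ->
  balanced N K R S (arr m aQty) ->
  m aCap i%:Z < U i ->
  (forall j, (j < K)%N -> (`|m aCost j%:Z| <= W)%N) ->
  (forall v, (v < N)%N -> (`|m aPrice v%:Z| <= W * 4 ^ e)%N) ->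
  (W * 4 ^ (e + N) < 2 ^ b)%N ->
  wp increment m (fun m' =>
    [/\ slackness K R S (arr m aCost) (arr m' aCap) (arr m' aQty) (arr m' aPrice),
        balanced N K R S (arr m' aQty),
        forall v, (v < N)%N -> (`|m' aPrice v%:Z| <= W * 4 ^ (e + N))%N
      & forall j : nat, m' aCap j%:Z = if j == i then m aCap i%:Z + 1 else m aCap j%:Z]).
Proof.
move=> E iK mi cs bal CU costW P0 Wb; have [_ _ ER ES EU] := E.
have [/andP[d0 dc] cs1 cs2] := cs _ iK.
(* The enlarged capacity is at most [U i], which is stored in [aMax] and so is covered by the memory
   bound. *)
have capb m' : m' aMax = m aMax -> bounded b m' -> (`|(m aCap i%:Z + 1)%R| < 2 ^ b)%N.
  by move=> Em bd; have := bd aMax i%:Z; rewrite Em EU //; lia.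
apply: wp_seq => //; apply: wp_write => //=; rewrite mi; first exact: capb.
set m1 := update _ _ _ _.
have C1 (j : nat) : m1 aCap j%:Z = if j == i then m aCap i%:Z + 1 else m aCap j%:Z.
  by rewrite /m1 /update /= eqz_nat.
have redE : eval m1 (eReduced (Var vOrder)) =
    reduced R S (arr m aCost) (arr m aPrice) i.
  by rewrite /eReduced /m1 /update /= mi ER // ES.
apply: wp_if => //; rewrite redE => red.
  have dE : m aQty i%:Z = m aCap i%:Z.
    apply/eqP; rewrite eq_le dc leNgt; apply/negP => /cs2; lia.
  apply: wp_seq => //; apply: wp_write => //=.
    rewrite /m1 /update /= mi dE; exact: capb.
  set m2 := update m1 _ _ _.
  have D2 (j : nat) : m2 aQty j%:Z = if j == i then m aQty i%:Z + 1 else m aQty j%:Z.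
    by rewrite /m2 /m1 /update /= mi eqz_nat.
  have fr2 a : a \notin [:: aCap; aQty] -> m2 a = m a.
    by rewrite !inE /m2 /m1 /update; case: (a == aCap) => //; case: (a == aQty).
  have m2C : m2 aCap = m1 aCap by [].
  have E2 : env m2.
    by apply: (env_frame E) => a; rewrite !inE => /or4P[] /eqP->; rewrite fr2.
  apply: (wp_weaken (@route_spec m2 i W e E2 iK _ _ _ _ _ _ Wb)).
  - by rewrite fr2.
  - rewrite (fr2 aCost) // (fr2 aPrice) // m2C => j jK; rewrite D2 C1; case: eqP => [->|_]; last exact: cs.
    by split=> //; rewrite ?dE; lia.
  - by rewrite D2 eqxx; lia.
  - move=> w wN; rewrite (@excess_update K R S (arr m aQty) _ i 1 _ iK); last first.
      by move=> j jK; rewrite D2; case: eqP => // ->.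
    by rewrite bal // !(eq_sym w); lia.
  - by rewrite fr2.
  - by rewrite fr2.
  move=> m3 fr3 [cs3 bal3 P3]; have m3C : m3 aCap = m1 aCap by rewrite fr3.
  split=> //; last by move=> j; rewrite m3C C1.
  by move: cs3; rewrite m3C m2C fr2.
apply: wp_skip => //; split=> //.
- move=> j jK; rewrite C1; case: eqP => [->|_]; last exact: cs.
  by rewrite /m1 /update /=; split=> //; lia.
- by move=> v vN; apply: leq_trans (P0 v vN) (weight_mono _ (leq_addr _ _)).
Qed.

(** The finer quotient is twice the coarser one plus a binary digit, and this digit is the unit of
    capacity that a phase may add. *)
Lemma divz_halve (u q : int) : 0 < q ->
  2 * (u %/ (2 * q))%Z <= (u %/ q)%Z <= 2 * (u %/ (2 * q))%Z + 1.
Proof.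
move=> q0; have q20 : 0 < 2 * q by lia.
have E1 := divz_eq u q; have E2 := divz_eq u (2 * q).
have r1 := modz_ge0 u (lt0r_neq0 q0); have r2 := modz_ge0 u (lt0r_neq0 q20).
have s1 := ltz_pmod u q0; have s2 := ltz_pmod u q20.
move: E1 E2 r1 r2 s1 s2.
set x := (u %/ q)%Z; set y := (u %/ (2 * q))%Z.
set r := (u %% q)%Z; set s := (u %% (2 * q))%Z => *.
by apply/andP; split; nia.
Qed.

Lemma scale_spec m k (W e : nat) : env m ->
  (forall j, (j < K)%N -> 0 <= U j) ->
  m vScale 0 = (2 ^ k.+1)%N%:Z ->
  (forall j, (j < K)%N -> m aCap j%:Z = (U j %/ (2 ^ k.+1)%N%:Z)%Z) ->
  slackness K R S (arr m aCost) (arr m aCap) (arr m aQty) (arr m aPrice) ->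
  balanced N K R S (arr m aQty) ->
  (forall j, (j < K)%N -> (`|m aCost j%:Z| <= W)%N) ->
  (forall v, (v < N)%N -> (`|m aPrice v%:Z| <= W * 4 ^ e)%N) ->
  (W * 4 ^ (e + K * N) < 2 ^ b)%N ->
  wp scale m (fun m' =>
    [/\ m' vScale 0 = (2 ^ k)%N%:Z,
        forall j, (j < K)%N -> m' aCap j%:Z = (U j %/ (2 ^ k)%N%:Z)%Z,
        slackness K R S (arr m aCost) (arr m' aCap) (arr m' aQty) (arr m' aPrice),
        balanced N K R S (arr m' aQty)
      & forall v, (v < N)%N -> (`|m' aPrice v%:Z| <= W * 4 ^ (e + K * N))%N]).
Proof.
move=> E U0 mpw HC cs bal costW P0 Wb; have [_ EK ER ES EU] := E.
have q0 : 0 < (2 ^ k)%N%:Z :> int by have := expn_gt0 2 k; lia.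
have pwS : (2 ^ k.+1)%N%:Z = 2 * (2 ^ k)%N%:Z :> int by rewrite expnS; lia.
have half : ((2 ^ k.+1)%N%:Z %/ 2)%Z = (2 ^ k)%N%:Z.
  by rewrite pwS mulrC mulzK.
have CU2 j : (j < K)%N -> 0 <= m aCap j%:Z + m aCap j%:Z <= U j.
  move=> jK; rewrite HC // pwS; have := divz_halve (U j) q0.
  have := divz_eq (U j) (2 ^ k)%N%:Z; have := modz_ge0 (U j) (lt0r_neq0 q0).
  have u0 : 0 <= (U j %/ (2 * (2 ^ k)%N%:Z))%Z.
    by rewrite divz_ge0 ?U0 //; lia.
  by move: q0; set q := (2 ^ k)%N%:Z; set x := (U j %/ q)%Z;
     set y := (U j %/ (2 * q))%Z; nia.
apply: wp_seq => //; apply: wp_write => //=.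
  by move=> bd; apply: leq_ltn_trans (lez_div _ _) (bd _ _).
rewrite mpw half; set m1 := update _ _ _ _.
have fr1 a : a != vScale -> m1 a = m a by rewrite /m1 /update => /negbTE ->.
pose Inv (i : nat) m' := forall j, (j < K)%N ->
  m' aQty j%:Z = (if (j < i)%N then m aQty j%:Z + m aQty j%:Z else m aQty j%:Z) /\
  m' aCap j%:Z = (if (j < i)%N then m aCap j%:Z + m aCap j%:Z else m aCap j%:Z).
apply: wp_seq => //.
apply: (wp_weaken (@wp_for b n Inv K m1 _ _ _ (Inv K) b0 Kn nb _ _ _ _ _)) => //.
- by move=> m' fr /=; rewrite fr //.
- move=> i m' fr iK mi I; have [ID IC] := I i iK; rewrite ltnn in ID IC.
  have capb m2 : m2 aMax = m' aMax -> bounded b m2 -> (`|U i| < 2 ^ b)%N.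
    by move=> E2 bd; have := bd aMax i%:Z; rewrite E2 fr // fr1 // EU.
  have C2 := CU2 i iK; have [/andP[d0 dc] _ _] := cs i iK.
  apply: wp_seq => //; apply: wp_write => //=; rewrite mi ID.
    by move=> /(capb _ erefl); lia.
  apply: wp_write => //=.
    rewrite /update /= mi IC => bd; apply: (@leq_ltn_trans `|U i|%N); first by lia.
    exact: capb bd.
  move=> j jK; rewrite /update /= mi IC eqz_nat ltnS_eqVlt.
  by have [-> ->] := I j jK; case: eqP => // ->; rewrite ltnn.
move=> m2 fr2 I2.
have {}I2 j : (j < K)%N -> m2 aQty j%:Z = m aQty j%:Z + m aQty j%:Z /\
    m2 aCap j%:Z = m aCap j%:Z + m aCap j%:Z.
  by move=> jK; have := I2 j jK; rewrite jK.
have fr12 a : a \notin [:: vScale; vArc; aQty; aCap] -> m2 a = m a.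
  rewrite !inE !negb_or => /and4P[h1 h2 h3 h4]; rewrite fr2 ?fr1 //.
  by rewrite !inE !negb_or h2 h3 h4.
have m2pw : m2 vScale 0 = (2 ^ k)%N%:Z by rewrite fr2 // /m1 /update.
have cs2 : slackness K R S (arr m aCost) (arr m2 aCap) (arr m2 aQty) (arr m aPrice).
  move=> j jK; have [-> ->] := I2 j jK; have [? c1 c2] := cs j jK.
  by split=> [|?|?]; [lia|apply: c1; lia|apply: c2; lia].
have bal2 : balanced N K R S (arr m2 aQty).
  move=> v vN; rewrite /excess (eq_bigr (fun j : 'I_K =>
     m aQty j%:Z * ((R j == v)%:Z - (S j == v)%:Z) +
     m aQty j%:Z * ((R j == v)%:Z - (S j == v)%:Z))).
    by rewrite big_split /= -/(excess K R S (arr m aQty) v) bal.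
  by move=> j _; have [-> _] := I2 j (ltn_ord j); rewrite mulrDl.
(* Each order treated may trigger a search of up to [N] rounds, hence the exponent [e + i * N]. *)
pose Inv2 (i : nat) m' :=
  [/\ slackness K R S (arr m aCost) (arr m' aCap) (arr m' aQty) (arr m' aPrice),
      balanced N K R S (arr m' aQty),
      forall v, (v < N)%N -> (`|m' aPrice v%:Z| <= W * 4 ^ (e + i * N))%N
    & forall j, (j < K)%N -> m' aCap j%:Z =
        if (j < i)%N then (U j %/ (2 ^ k)%N%:Z)%Z else m aCap j%:Z + m aCap j%:Z].
apply: (@wp_for b n Inv2 K) => //.
- by move=> m' fr /=; rewrite fr // fr12.
- split.
  + by rewrite -(fr12 aPrice) in cs2.
  + exact: bal2.
  + by move=> v vN; rewrite mul0n addn0 /update /= fr12 //; apply: P0.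
  + by move=> j jK; rewrite /update /=; have [_ ->] := I2 j jK.
- move=> i m' fr iK mi [cs' bal' P' C'].
  have E' : env m'.
    by apply: (env_frame E) => a; rewrite !inE => /or4P[] /eqP->; rewrite fr // fr12.
  have cost' : m' aCost = m aCost by rewrite fr // fr12.
  have test : eval m' (Read aMax (Var vOrder) [/] Var vScale [-] Read aCap (Var vOrder)) =
      (U i %/ (2 ^ k)%N%:Z)%Z - (m aCap i%:Z + m aCap i%:Z).
    by rewrite /= mi !(fr aMax, fr vScale) // m2pw (fr12 aMax) // EU // C' // ltnn.
  have dh := divz_halve (U i) q0; rewrite -pwS -HC // in dh.
  have step : forall v, (v < N)%N -> (`|m' aPrice v%:Z| <= W * 4 ^ (e + i.+1 * N))%N.
    move=> v vN; apply: leq_trans (P' v vN) (weight_mono _ _).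
    by rewrite leq_add2l leq_mul2r leqnSn orbT.
  apply: wp_if => //; rewrite test => Hpos.
    apply: (wp_weaken (@increment_spec m' i W (e + i * N) E' iK mi _ bal' _ _ P' _)).
    + by rewrite cost'.
    + rewrite C' // ltnn; have := divz_eq (U i) (2 ^ k)%N%:Z.
      have := modz_ge0 (U i) (lt0r_neq0 q0); have := U0 i iK.
      by have [/andP[]] := cs i iK; nia.
    + by rewrite cost'.
    + apply: leq_ltn_trans Wb; apply: weight_mono.
      by rewrite -addnA leq_add2l addnC -mulSn leq_mul2r iK orbT.
    move=> m3 fr3 [cs3 bal3 P3 C3]; rewrite cost' in cs3; split=> //.
    + by move=> v vN; have := P3 v vN; rewrite -addnA (addnC (i * N)%N) -mulSn.
    + move=> j jK; rewrite /update /= C3 ltnS_eqVlt !C' //.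
      by case: eqP => [->|_] //=; rewrite ltnn; lia.
  apply: wp_skip => //; split=> //.
  move=> j jK; rewrite /update /= C' // ltnS_eqVlt.
  by case: eqP => [->|_] //=; rewrite ltnn; lia.
- move=> m' fr [cs' bal' P' C']; split=> //.
  + by rewrite fr.
  + by move=> j jK; rewrite C' // jK.
Qed.

Lemma solve_spec m (M : int) (W F : nat) : env m ->
  (forall j, (j < K)%N -> 0 <= U j < M) ->
  m vWeight 0 = M -> 0 < M -> (`|M| <= 2 ^ F)%N -> (F <= n)%N -> (F < b)%N ->
  (forall j, (j < K)%N -> (`|m aCost j%:Z| <= W)%N) ->
  (W * 4 ^ (F * (K * N)) < 2 ^ b)%N ->
  wp solve m (fun m' =>
    slackness K R S (arr m aCost) U (arr m' aQty) (arr m' aPrice) /\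
    balanced N K R S (arr m' aQty) /\
    forall v, (v < N)%N -> (`|m' aPrice v%:Z| <= W * 4 ^ (F * (K * N)))%N).
Proof.
move=> E UM mM M0 MF Fn Fb costW Wb; have [En EK ER ES EU] := E.
pose Inv1 k m' := forall j, (j < k)%N -> m' aQty j%:Z = 0 /\ m' aCap j%:Z = 0.
apply: wp_seq => //.
apply: (wp_weaken (@wp_for b n Inv1 K m _ _ _ (Inv1 K) b0 Kn nb _ _ _ _ _)) => //.
- by move=> m' fr /=; rewrite fr.
- move=> k m' fr kK mk I.
  apply: wp_seq => //; apply: wp_write => //=; first by rewrite expn_gt0.
  apply: wp_write => //=; first by rewrite expn_gt0.
  move=> j; rewrite ltnS_eqVlt /update /= mk eqz_nat.
  by case: eqP => //= _; apply: I.
move=> m1 fr1 I1.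
pose Inv2 k m' := forall j, (j < k)%N -> m' aPrice j%:Z = 0.
apply: wp_seq => //.
apply: (wp_weaken (@wp_for b n Inv2 N m1 _ _ _ (Inv2 N) b0 Nn nb _ _ _ _ _)) => //.
- by move=> m' fr /=; rewrite fr // fr1 // En; lia.
- move=> k m' fr kK mk I.
  apply: wp_write => //=; first by rewrite expn_gt0.
  rewrite mk => j; rewrite ltnS_eqVlt /update /= eqz_nat.
  by case: eqP => //= _; apply: I.
move=> m2 fr2 I2.
apply: wp_seq => //; apply: wp_write => //=.
  by move=> _; rewrite -[1%N]/(2 ^ 0)%N ltn_exp2l.
set m3 := update _ _ _ _.
pose Inv3 k m' := exists l, (k + l)%N = F /\ m' vScale 0 = (2 ^ l)%N%:Z.
have m3M : m3 vWeight 0 = M by rewrite /m3 /update /= fr2 // fr1.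
apply: wp_seq => //.
have W3 : wp (WhilePos (Var vWeight [-] Var vScale) (set vScale (Var vScale [+] Var vScale))) m3
    (fun m' => exists l, [/\ (l <= F)%N, m' vScale 0 = (2 ^ l)%N%:Z & M <= (2 ^ l)%N%:Z]).
  apply: (@wp_while b n b0 Inv3 F) => //.
  - by exists 0%N; rewrite addn0.
  - move=> k m' fr [l [kl pw]] /=; rewrite pw fr // m3M => lt.
    have lF : (l < F)%N.
      by rewrite -(ltn_exp2l _ _ (isT : 1 < 2)%N); lia.
    have dbl : (2 ^ l)%N%:Z + (2 ^ l)%N%:Z = (2 ^ l.+1)%N%:Z :> int.
      by rewrite expnS; lia.
    exists k.-1; split; first by lia.
    apply: wp_write => //=; rewrite pw dbl.
      by move=> _; rewrite absz_nat ltn_exp2l //; lia.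
    by exists l.+1; split; first by lia.
  - move=> k m' _ fr [l [kl pw]] /=; rewrite pw fr // m3M => le.
    by exists l; split=> //; lia.
apply: (wp_weaken W3) => m4 fr4 [l [lF pw Ml]].
have fr a : a \notin [:: aQty; aCap; aPrice; vOrder; vVertex; vScale] -> m4 a = m a.
  rewrite !inE !negb_or => /and5P[h1 h2 h3 h4 /andP[h5 h6]].
  rewrite fr4 ?inE // /m3 /update (negbTE h6) /= -[RHS]fr1.
    by apply: fr2; rewrite !inE !negb_or h5 h3.
  by rewrite !inE !negb_or h4 h1 h2.
have E4 : env m4.
  by apply: (env_frame E) => a; rewrite !inE => /or4P[] /eqP->; rewrite fr.
(* Phases are counted from [F], although the scale starts at [2 ^ l] with [l <= F]; prices are 0
   there, so any bound holds initially. *)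
pose Inv4 k m' :=
    [/\ m' vScale 0 = (2 ^ k)%N%:Z,
        forall j, (j < K)%N -> m' aCap j%:Z = (U j %/ (2 ^ k)%N%:Z)%Z,
        slackness K R S (arr m aCost) (arr m' aCap) (arr m' aQty) (arr m' aPrice),
        balanced N K R S (arr m' aQty)
      & (k <= F)%N /\ forall v, (v < N)%N -> (`|m' aPrice v%:Z| <= W * 4 ^ ((F - k) * (K * N)))%N].
have D4 j : (j < K)%N -> m4 aQty j%:Z = 0 /\ m4 aCap j%:Z = 0.
  by move=> jK; rewrite !fr4 // /m3 /update /= !fr2 //; apply: I1.
have P4 v : (v < N)%N -> m4 aPrice v%:Z = 0.
  by move=> vN; rewrite fr4 // /m3 /update /=; apply: I2.
apply: (@wp_while b n b0 Inv4 l); first exact: leq_trans Fn.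
- split=> //.
  + move=> j jK; have [_ ->] := D4 j jK; have := UM j jK.
    by move=> H; rewrite divz_small //; lia.
  + by move=> j jK; have [-> ->] := D4 j jK; split; rewrite ?ltxx.
  + move=> v vN; apply: big1 => j _; have [-> _] := D4 j (ltn_ord j).
    by rewrite mul0r.
  + by split=> // v vN; rewrite P4.
- move=> k m' fr' [pw' C' cs' bal' [kF P']] /=; rewrite pw'.
  case: k pw' C' kF P' => [|k] pw' C' kF P'; first by rewrite expn0; lia.
  move=> _; exists k; split=> //.
  have frm a : a \notin [:: aQty; aCap; aPrice; vOrder; vVertex; vScale] ++ writes scale -> m' a = m a.
    by rewrite mem_cat negb_or => /andP[h1 h2]; rewrite fr' // fr.
  have E' : env m'.
    by apply: (env_frame E) => a; rewrite !inE => /or4P[] /eqP->; rewrite frm.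
  have eE : ((F - k.+1) * (K * N) + K * N = (F - k) * (K * N))%N.
    by rewrite addnC -mulSn; congr (_ * _)%N; lia.
  apply: (wp_weaken (@scale_spec m' k W _ E' _ pw' C' _ bal' _ P' _)).
  + by move=> j /UM /andP[].
  + by rewrite (frm aCost).
  + by rewrite (frm aCost).
  + apply: leq_ltn_trans Wb; apply: weight_mono.
    by rewrite eE leq_mul2r leq_subr orbT.
  move=> m5 fr5 [pw5 C5 cs5 bal5 P5]; split=> //.
    by rewrite (frm aCost) in cs5.
  by split; [exact: ltnW|rewrite -eE].
- move=> k m' _ fr' [pw' C' cs' bal' [kF P']] /=; rewrite pw' => le.
  have k0 : k = 0%N by case: k le {pw' C' kF P'} => // k; rewrite expnS; have := expn_gt0 2 k; lia.
  subst k; rewrite subn0 in P'; split; last by split.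
  apply: (slackness_eq RN SN _ _ cs') => // j jK; split=> //.
  by rewrite C' // expn0 divz1.
Qed.

(** * Reading the instance and assembling the solver *)

Variables (q p : nat -> nat -> int).
Hypothesis qE : forall j t, (j < K)%N -> (t < nt)%N ->
  q j t = if t == R j then 1 else if t == S j then -1 else 0.

Definition input (m : memory) :=
  [/\ m 0%N 0 = nt%:Z, m 0%N 1 = K%:Z,
      forall j t, (j < K)%N -> (t < nt)%N ->
        m 0%N (2 + nt + K + (j * nt + t))%N%:Z = q j t,
      forall j t, (j < K)%N -> (t < nt)%N ->
        m 0%N (2 + nt + K + K * nt + (j * nt + t))%N%:Z = p j t
    & forall j, (j < K)%N ->
        m 0%N (2 + nt + K + 2 * (K * nt) + j)%N%:Z = U j].

Lemma input_frame m m' : input m -> m' 0%N = m 0%N -> input m'.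
Proof. by move=> E H; rewrite /input H. Qed.

Definition cost j : int := \sum_(t < nt) p j t * q j t.

Lemma read_order_spec m i (A : nat) : input m -> (i < K)%N -> m vOrder 0 = i%:Z ->
  m aDemand i%:Z = nt%:Z -> m aOffer i%:Z = nt%:Z -> m aCost i%:Z = 0 ->
  (forall t, (t < nt)%N -> (`|p i t| <= A)%N) -> (nt * A < 2 ^ b)%N ->
  wp read_order m (fun m' =>
    [/\ m' aDemand i%:Z = (R i)%:Z, m' aOffer i%:Z = (S i)%:Z, m' aCost i%:Z = cost i
      & forall a j, a \in [:: aDemand; aOffer; aCost] -> j != i%:Z -> m' a j = m a j]).
Proof.
move=> [ET EK EQ EP _] iK mi mR mS mc pA Ab.
have [RiN SiN] := (RN iK, SN iK).
pose cst (k : nat) : int := \sum_(t < k) p i t * q i t.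
pose Inv (k : nat) m' :=
  [/\ m' aDemand i%:Z = (if (R i < k)%N then R i else nt)%:Z,
      m' aOffer i%:Z = (if (S i < k)%N then S i else nt)%:Z,
      m' aCost i%:Z = cst k, (`|cst k| <= k * A)%N
    & forall a j, a \in [:: aDemand; aOffer; aCost] -> j != i%:Z -> m' a j = m a j].
have ntn : (nt <= n)%N by exact: ltnW.
apply: (@wp_for b n Inv nt) => //.
- by move=> m' fr /=; rewrite fr.
- split=> //; rewrite /update /= /cst ?big_ord0 //.
  by move=> a j ha _; move: ha; rewrite !inE => /or3P[] /eqP->.
- move=> k m' fr kN mk [IR IS Ic Ib Io].
  have mi' : m' vOrder 0 = i%:Z by rewrite fr.
  have addrQ : 2 + nt%:Z + K%:Z + (i%:Z * nt%:Z + k%:Z) =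
    (2 + nt + K + (i * nt + k))%N%:Z by lia.
  have addrP : 2 + nt%:Z + K%:Z + K%:Z * nt%:Z + (i%:Z * nt%:Z + k%:Z) =
    (2 + nt + K + K * nt + (i * nt + k))%N%:Z by lia.
  have evQ m1 : m1 0%N = m' 0%N -> m1 vOrder = m' vOrder -> m1 vVertex = m' vVertex ->
      eval m1 (Read 0 (eQBase [+] eEntry)) = q i k.
    by move=> E0 EI EV; rewrite /= E0 EI EV mi' mk !(fr 0%N) // ET EK addrQ EQ.
  have evP m1 : m1 0%N = m' 0%N -> m1 vOrder = m' vOrder -> m1 vVertex = m' vVertex ->
      eval m1 (Read 0 (eQBase [+] eNI [*] eNT [+] eEntry)) = p i k.
    by move=> E0 EI EV; rewrite /= E0 EI EV mi' mk !(fr 0%N) // ET EK addrP EP.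
  have qk := qE iK kN.
  pose Mid m1 := [/\ m1 0%N = m' 0%N, m1 vOrder = m' vOrder, m1 vVertex = m' vVertex,
    m1 aCost = m' aCost & [/\ m1 aDemand i%:Z = (if (R i < k.+1)%N then R i else nt)%:Z,
      m1 aOffer = m' aOffer
    & forall j, j != i%:Z -> m1 aDemand j = m aDemand j]].
  have kb : (`|k%:Z| < 2 ^ b)%N by apply: small_lt; lia.
  apply: wp_seq => //; apply: (@wp_weaken b n _ _ Mid).
    apply: wp_if => //; rewrite evQ // qk => H.
      apply: wp_write => //=.
      have kR : k = R i by move: H; case: eqP => // _; case: eqP.
      rewrite mi' mk; split=> //; split=> //.
        by rewrite /update /= eqxx ltnS kR leqnn.
      by move=> j ji; rewrite /update /= (negbTE ji) Io.
    apply: wp_skip => //; split=> //; split=> //; last by move=> j ji; rewrite Io.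
    rewrite IR ltnS_eqVlt; case: eqP => //= E; move: H; rewrite E eqxx; lia.
  move=> m1 _ [M0 MI MV Mc [MR MS Mo]].
  pose Mid2 m1 := [/\ m1 0%N = m' 0%N, m1 vOrder = m' vOrder, m1 vVertex = m' vVertex,
    m1 aCost = m' aCost & [/\ m1 aDemand i%:Z = (if (R i < k.+1)%N then R i else nt)%:Z,
      m1 aOffer i%:Z = (if (S i < k.+1)%N then S i else nt)%:Z,
      forall j, j != i%:Z -> m1 aDemand j = m aDemand j
    & forall j, j != i%:Z -> m1 aOffer j = m aOffer j]].
  apply: wp_seq => //; apply: (@wp_weaken b n _ _ Mid2).
    have evN : eval m1 (Const 0 [-] Read 0 (eQBase [+] eEntry)) = - q i k.
      by rewrite -(evQ m1) //= sub0r.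
    have mk1 : m1 vVertex 0 = k by rewrite MV.
    have mi1 : m1 vOrder 0 = i by rewrite MI.
    have RSi := RS iK.
    apply: wp_if => //; rewrite evN qk => H.
      apply: wp_write => //=.
      have kS : k = S i by move: H; case: eqP => // _; case: eqP.
      rewrite mi1 mk1; split=> //; split=> //.
      - by rewrite /update /= eqxx ltnS kS leqnn.
      - by move=> j ji; rewrite /update /= (negbTE ji) MS Io.
    apply: wp_skip => //; split=> //; split=> //; last first.
      by move=> j ji; rewrite MS Io.
    rewrite MS IS ltnS_eqVlt; case: eqP => //= E.
    by move: H; rewrite -E eqxx eq_sym (negbTE RSi); lia.
  move=> m2 _ [M0' MI' MV' Mc' [MR' MS' Mo' Mo2']].
  have evc : eval m2 (Read aCost (Var vOrder) [+]
             Read 0 (eQBase [+] eNI [*] eNT [+] eEntry) [*]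
             Read 0 (eQBase [+] eEntry)) = cst k.+1.
    have := evQ m2 M0' MI' MV'; have := evP m2 M0' MI' MV' => /= -> ->.
    by rewrite MI' mi' Mc' Ic /cst big_ord_recr.
  have cb : (`|cst k.+1| <= k.+1 * A)%N.
    rewrite /cst big_ord_recr /= -/(cst k) mulSn.
    by have := pA k kN; rewrite qk; case: eqP => _; [|case: eqP => _]; lia.
  apply: wp_write => //; rewrite evc.
    by move=> _; apply: leq_ltn_trans Ab; apply: leq_trans cb _; rewrite leq_mul2r kN orbT.
  rewrite /= MI' mi'; split=> //.
  + by rewrite /update /= eqxx.
  + move=> a j; rewrite !inE /update => /or3P[] /eqP-> ji /=.
    * exact: Mo'.
    * exact: Mo2'.
    * by rewrite (negbTE ji) Mc' Io.
- move=> m' fr [IR IS Ic _ Io]; split=> //.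
  + by rewrite IR; case: ltnP => // H; have -> : R i = nt by lia.
  + by rewrite IS; case: ltnP => // H; have -> : S i = nt by lia.
Qed.

(** It serves twice: it exceeds every single capacity, which starts the scaling, and the total
    capacity, as the perturbed gains require of M. *)
Definition max_total : int := 1 + \sum_(j < K) U j.

Lemma read_input_spec m (A : nat) : input m ->
  (forall j, (j < K)%N -> 0 <= U j) ->
  (forall j t, (j < K)%N -> (t < nt)%N -> (`|p j t| <= A)%N) ->
  (nt * A < 2 ^ b)%N -> (`|max_total| < 2 ^ b)%N ->
  wp read_input m (fun m' =>
    [/\ env m', forall j, (j < K)%N -> m' aCost j%:Z = cost j
      & m' vWeight 0 = max_total]).
Proof.
move=> I0 U0 pA Ab Mb; have [ET EK _ _ EU] := I0.
pose Inv (i : nat) m' := [/\ m' vWeight 0 = 1 + \sum_(j < i) U j,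
  forall j, (j < i)%N -> m' aDemand j%:Z = (R j)%:Z,
  forall j, (j < i)%N -> m' aOffer j%:Z = (S j)%:Z,
  forall j, (j < i)%N -> m' aMax j%:Z = U j
  & forall j, (j < i)%N -> m' aCost j%:Z = cost j].
apply: wp_seq => //; apply: wp_write => //=.
  by move=> _; rewrite -[1%N]/(2 ^ 0)%N ltn_exp2l.
set m1 := update _ _ _ _.
apply: (@wp_for b n Inv K) => //.
- by move=> m' fr /=; rewrite fr.
- by split=> //; rewrite /m1 /update /= big_ord0 addr0.
- move=> k m' fr kK mk [IM IR IS IU Ic].
  have m'0 : m' 0%N = m 0%N by rewrite fr.
  have addrU : 2 + nt%:Z + K%:Z + 2 * (K%:Z * nt%:Z) + k%:Z =
    (2 + nt + K + 2 * (K * nt) + k)%N%:Z by lia.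
  apply: wp_seq => //; apply: wp_write => //=.
  apply: wp_seq => //; apply: wp_write => //=.
  apply: wp_seq => //; apply: wp_write => //=; first by rewrite expn_gt0.
  apply: wp_seq => //; apply: wp_write => //=.
  have ev0 x y z : update (update (update m' aDemand x y) aOffer x z) aCost x 0 0%N = m' 0%N.
    by [].
  set m2 := update _ aMax _ _.
  have m2M : m2 vWeight 0 = 1 + \sum_(j < k) U j by rewrite -IM.
  have m2I : m2 vOrder 0 = k%:Z by rewrite -mk.
  have m2U j : m2 aMax j = if j == k%:Z then U k else m' aMax j.
    by rewrite /m2 /update /= mk m'0 ET EK addrU EU.
  have m2R j : m2 aDemand j = if j == k%:Z then nt%:Z else m' aDemand j.
    by rewrite /m2 /update /= mk m'0 ET.
  have m2S j : m2 aOffer j = if j == k%:Z then nt%:Z else m' aOffer j.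
    by rewrite /m2 /update /= mk m'0 ET.
  have m2c j : m2 aCost j = if j == k%:Z then 0 else m' aCost j.
    by rewrite /m2 /update /= mk.
  have m2_0 : m2 0%N = m 0%N by [].
  clearbody m2.
  have Mk : 1 + \sum_(j < k) U j + U k = 1 + \sum_(j < k.+1) U j.
    by rewrite big_ord_recr /= addrA.
  have evM : eval m2 (Var vWeight [+] Read aMax (Var vOrder)) = 1 + \sum_(j < k.+1) U j.
    by rewrite /= m2M m2I m2U eqxx Mk.
  apply: wp_seq => //; apply: wp_write => //; rewrite evM.
    move=> _; apply: leq_ltn_trans Mb.
    have H : \sum_(j < k.+1) U j <= \sum_(j < K) U j.
      rewrite (big_ord_widen K (fun j => U j) kK) big_mkcond /=.
      by apply: ler_sum => j _; case: ifP => // _; apply: U0.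
    have : 0 <= \sum_(j < k.+1) U j.
      by apply: sumr_ge0 => j _; apply: U0; apply: leq_trans kK.
    by rewrite /max_total; lia.
  set m3 := update _ _ _ _.
  apply: (wp_weaken (@read_order_spec m3 k A _ kK _ _ _ _ _ Ab)).
  + by apply: (input_frame I0).
  + exact: m2I.
  + by rewrite /m3 /update /= m2R eqxx.
  + by rewrite /m3 /update /= m2S eqxx.
  + by rewrite /m3 /update /= m2c eqxx.
  + by move=> t; apply: pA.
  move=> m4 fr4 [HR HS Hc Ho].
  have m4M : m4 vWeight 0 = 1 + \sum_(j < k.+1) U j by rewrite fr4.
  have m4U j : m4 aMax j = m2 aMax j by rewrite fr4.
  split=> //.
  + move=> j; rewrite ltnS_eqVlt; case: eqP => [-> //|/eqP jk] /= jl.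
    by rewrite /update /= Ho // ?eqz_nat // /m3 /update /= m2R eqz_nat (negbTE jk) IR.
  + move=> j; rewrite ltnS_eqVlt; case: eqP => [-> //|/eqP jk] /= jl.
    by rewrite /update /= Ho // ?eqz_nat // /m3 /update /= m2S eqz_nat (negbTE jk) IS.
  + move=> j; rewrite ltnS_eqVlt /update /= m4U m2U eqz_nat.
    by case: eqP => [-> //|_] /= jl; rewrite IU.
  + move=> j; rewrite ltnS_eqVlt; case: eqP => [-> //|/eqP jk] /= jl.
    by rewrite /update /= Ho // ?eqz_nat // /m3 /update /= m2c eqz_nat (negbTE jk) Ic.
- move=> m' fr [IM IR IS IU Ic]; split=> //.
  by split=> //; rewrite fr.
Qed.

Lemma write_prices_spec m : env m ->
  (forall t, (t < nt)%N -> (`|(m aPrice t%:Z - m aPrice nt%:Z)%R| < 2 ^ b)%N) ->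
  wp write_prices m (fun m' => forall t, (t < nt)%N ->
    m' 2%N t%:Z = m aPrice t%:Z - m aPrice nt%:Z).
Proof.
move=> [ET EK _ _ _] Pb.
pose Inv (k : nat) m' := forall t, (t < k)%N -> m' 2%N t%:Z = m aPrice t%:Z - m aPrice nt%:Z.
apply: (@wp_for b n Inv nt) => //; first exact: ltnW.
- by move=> m' fr /=; rewrite fr.
- move=> k m' fr kN mk I; apply: wp_write => //=; rewrite mk !fr // ET.
    by move=> _; apply: Pb.
  move=> t; rewrite ltnS_eqVlt /update /= eqz_nat.
  by case: eqP => [-> //|_] /= /I.
Qed.

Lemma perturb_costs_spec m (M : int) (c : nat -> int) : env m ->
  m vWeight 0 = M -> (forall j, (j < K)%N -> m aCost j%:Z = c j) ->
  (forall j, (j < K)%N -> (`|(M * c j + 1)%R| < 2 ^ b)%N) ->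
  wp perturb_costs m (fun m' => forall j, (j < K)%N ->
    m' aCost j%:Z = M * c j + 1).
Proof.
move=> [ET EK _ _ _] EM Ec cb.
pose Inv (k : nat) m' := forall j, (j < K)%N ->
  m' aCost j%:Z = if (j < k)%N then M * c j + 1 else c j.
apply: (@wp_for b n Inv K) => //.
- by move=> m' fr /=; rewrite fr.
- move=> k m' fr kK mk I.
  apply: wp_write => //=; rewrite mk I // ltnn (fr vWeight) // EM.
    by move=> _; apply: cb.
  move=> j jK; rewrite ltnS_eqVlt /update /= eqz_nat I //.
  by case: eqP => [-> //|_].
- by move=> m' fr I j jK; rewrite I // jK.
Qed.

Lemma write_quantities_spec m : env m ->
  wp write_quantities m (fun m' => forall j, (j < K)%N ->
    m' 1%N j%:Z = m aQty j%:Z).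
Proof.
move=> [ET EK _ _ _].
pose Inv (k : nat) m' := forall t, (t < k)%N -> m' 1%N t%:Z = m aQty t%:Z.
apply: (@wp_for b n Inv K) => //.
- by move=> m' fr /=; rewrite fr.
- move=> k m' fr kN mk I; apply: wp_write => //=; rewrite mk !fr //.
  move=> t; rewrite ltnS_eqVlt /update /= eqz_nat.
  by case: eqP => [-> //|_] /= /I.
Qed.

(** [W] dominates both the original and the perturbed gains, so the same bound serves both runs of
    [solve]; the factor 2 leaves room for the difference of two potentials. *)
Lemma auction_solver_spec m (A W F : nat) : input m ->
  (forall j, (j < K)%N -> 0 <= U j) ->
  (forall j t, (j < K)%N -> (t < nt)%N -> (`|p j t| <= A)%N) ->
  (nt * A < 2 ^ b)%N -> (`|max_total| <= 2 ^ F)%N -> (F <= n)%N -> (F < b)%N ->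
  (forall j, (j < K)%N -> (`|max_total| * `|cost j| < W)%N) ->
  (W * 4 ^ (F * (K * N)) * 2 < 2 ^ b)%N ->
  wp auction_solver m (fun m' => exists pi,
    [/\ forall t, (t < nt)%N -> m' 2%N t%:Z = pi t - pi nt,
        slackness K R S cost U (arr m' 1%N) pi,
        balanced N K R S (arr m' 1%N)
      & forall d pi', slackness K R S cost U d pi' -> balanced N K R S d ->
          \sum_(j < K) d j <= \sum_(j < K) m' 1%N j%:Z]).
Proof.
move=> I0 U0 pA Ab MF Fn Fb cW Wb.
have Us : 0 <= \sum_(j < K) U j by apply: sumr_ge0 => j _; apply: U0.
have M0 : 0 < max_total by rewrite /max_total; lia.
have UM j : (j < K)%N -> 0 <= U j < max_total.
  move=> jK; rewrite U0 //= /max_total (bigD1 (Ordinal jK)) //=.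
  by rewrite addrCA ltrDl ltr_pwDl // sumr_ge0 // => i _; apply: U0.
have Mb : (`|max_total| < 2 ^ b)%N.
  by apply: leq_ltn_trans MF _; rewrite ltn_exp2l.
have Wb' : (W * 4 ^ (F * (K * N)) < 2 ^ b)%N by lia.
have W_b : (W < 2 ^ b)%N.
  by apply: leq_ltn_trans Wb'; rewrite leq_pmulr // expn_gt0.
have cW1 j : (j < K)%N -> (`|cost j| <= W)%N.
  move=> jK; apply: leq_trans (ltnW (cW j jK)); rewrite leq_pmull //; lia.
have cW2 j : (j < K)%N -> (`|(max_total * cost j + 1)%R| <= W)%N.
  by move=> jK; have := cW j jK; rewrite -abszM; lia.
apply: wp_seq => //.
apply: (wp_weaken (@read_input_spec m A I0 U0 pA Ab Mb)) => m1 fr1 [E1 c1 M1].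
apply: wp_seq => //.
apply: (wp_weaken (@solve_spec m1 max_total W F E1 UM M1 M0 MF Fn Fb _ Wb')).
  by move=> j jK; rewrite c1 // cW1.
move=> m2 fr2 [cs0 [bal0 P0]].
have E2 : env m2.
  by apply: (env_frame E1) => a; rewrite !inE => /or4P[] /eqP->; rewrite fr2.
have M2 : m2 vWeight 0 = max_total by rewrite fr2.
have c2 j : (j < K)%N -> m2 aCost j%:Z = cost j by rewrite fr2 //; apply: c1.
apply: wp_seq => //; apply: (wp_weaken (@write_prices_spec m2 E2 _)).
  move=> t tn; have := P0 nt (ltnSn _); have := P0 t (ltnW tn); lia.
move=> m3 fr3 out2.
have E3 : env m3.
  by apply: (env_frame E2) => a; rewrite !inE => /or4P[] /eqP->; rewrite fr3.
apply: wp_seq => //.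
apply: (wp_weaken (@perturb_costs_spec m3 max_total cost E3 _ _ _)).
- by rewrite fr3.
- by rewrite fr3.
- by move=> j jK; apply: leq_ltn_trans (cW2 j jK) W_b.
move=> m4 fr4 c4.
have E4 : env m4.
  by apply: (env_frame E3) => a; rewrite !inE => /or4P[] /eqP->; rewrite fr4.
apply: wp_seq => //.
apply: (wp_weaken (@solve_spec m4 max_total W F E4 UM _ M0 MF Fn Fb _ Wb')).
- by rewrite fr4 // fr3.
- by move=> j jK; rewrite c4 // cW2.
move=> m5 fr5 [cs1 [bal1 _]].
have E5 : env m5.
  by apply: (env_frame E4) => a; rewrite !inE => /or4P[] /eqP->; rewrite fr5.
apply: (wp_weaken (@write_quantities_spec m5 E5)) => m6 fr6 out1.
have m6_2 : m6 2%N = m3 2%N by rewrite fr6 // fr5 // fr4.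
have cs0' : slackness K R S cost U (arr m2 aQty) (arr m2 aPrice).
  by apply: (slackness_eq RN SN _ _ cs0) => // j jK; rewrite c1.
have cs1' : slackness K R S (fun j => max_total * cost j + 1) U (arr m6 1%N) (arr m5 aPrice).
  by apply: (slackness_eq RN SN _ _ cs1) => // j jK; rewrite c4 // out1.
have bal1' : balanced N K R S (arr m6 1%N).
  by move=> v vN; rewrite -(bal1 v vN); apply: excess_eq => j jK; rewrite out1.
have ltM : \sum_(j < K) U j < max_total by rewrite /max_total; lia.
have [cs opt] := lexicographic_optimum RN SN cs0' bal0 cs1' bal1' ltM.
by exists (arr m2 aPrice); split=> // t tn; rewrite m6_2 out2.
Qed.

End Spec.

(** * Polynomial bounds and the encoding of instances *)

Definition poly_bounded (f : nat -> nat) :=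
  exists c d, forall x, (f x <= c * x ^ d + c)%N.

Lemma poly_bounded_const k : poly_bounded (fun=> k).
Proof. by exists k, 0%N => x; rewrite leq_addl. Qed.

Lemma poly_bounded_id : poly_bounded id.
Proof. by exists 1%N, 1%N => x; rewrite mul1n expn1 leq_addr. Qed.

(** The summand 1 is for [x = 0] and [d = 0], where the left power is 1 and the right one may be
    0. *)
Lemma expn_leD x d d' : (x ^ d <= x ^ (d + d') + 1)%N.
Proof.
case: x => [|x]; last by apply: leq_trans (leq_addr _ _); rewrite leq_pexp2l // leq_addr.
by case: d => [|d]; [rewrite expn0 leq_addl | rewrite exp0n].
Qed.

Lemma poly_boundedD f g :
  poly_bounded f -> poly_bounded g -> poly_bounded (fun x => f x + g x)%N.
Proof.
move=> [c [d Hf]] [c' [d' Hg]]; exists (2 * (c + c'))%N, (d + d')%N => x.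
have := Hf x; have := Hg x; have := expn_leD x d d'; have := expn_leD x d' d.
rewrite (addnC d' d); set u := (x ^ d)%N; set v := (x ^ d')%N.
set w := (x ^ (d + d'))%N => h1 h2 h3 h4.
have := leq_mul (leqnn c) h2; have := leq_mul (leqnn c') h1.
by rewrite !mulnDr !mulnDl; lia.
Qed.

Lemma poly_boundedM f g :
  poly_bounded f -> poly_bounded g -> poly_bounded (fun x => f x * g x)%N.
Proof.
move=> [c [d Hf]] [c' [d' Hg]]; exists (4 * (c * c'))%N, (d + d')%N => x.
apply: leq_trans (leq_mul (Hf x) (Hg x)) _.
have := expn_leD x d d'; have := expn_leD x d' d.
rewrite (addnC d' d) expnD; set u := (x ^ d)%N; set v := (x ^ d')%N => h1 h2.
have -> : ((c * u + c) * (c' * v + c') = c * c' * (u * v + u + v + 1))%N by ring.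
have -> : (4 * (c * c') * (u * v) + 4 * (c * c') = c * c' * (4 * (u * v) + 4))%N by ring.
by apply: leq_mul => //; lia.
Qed.

Lemma poly_boundedX f k : poly_bounded f -> poly_bounded (fun x => f x ^ k)%N.
Proof.
move=> pf; elim: k => [|k IH]; first exact: poly_bounded_const.
by have [c [d H]] := poly_boundedM pf IH; exists c, d => x; rewrite expnS.
Qed.

(** Only loops multiply by [f x], so for a fixed program the number of such factors is its loop
    nesting depth. *)
Lemma poly_bounded_prog_cost f c :
  poly_bounded f -> poly_bounded (fun x => prog_cost (f x) c).
Proof.
move=> pf; elim: c => [|a e1 e2|c1 IH1 c2 IH2|e c1 IH1 c2 IH2|e c IH] /=.
- exact: poly_bounded_const.
- exact: poly_bounded_const.
- by do !apply: poly_boundedD => //; exact: poly_bounded_const.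
- by do !apply: poly_boundedD => //; exact: poly_bounded_const.
- apply: poly_boundedD (poly_bounded_const _).
  apply: poly_boundedD (poly_bounded_const _); apply: poly_boundedM => //.
  apply: poly_boundedD (poly_bounded_const _).
  by apply: poly_boundedD => //; exact: poly_bounded_const.
Qed.

Lemma nth_allpairs (A B C : Type) (f : A -> B -> C) (s : seq A) (t : seq B)
    x0 a0 b0 i j : (i < size s)%N -> (j < size t)%N ->
  nth x0 [seq f a b | a <- s, b <- t] (i * size t + j) = f (nth a0 s i) (nth b0 t j).
Proof.
move=> + jt; elim: s i => [|a s IH] [|i] //= it; rewrite nth_cat size_map.
  by rewrite mul0n add0n jt (nth_map b0).
by rewrite mulSn -addnA ltnNge leq_addr /= addKn IH.
Qed.

Lemma size_map_enum_ord (T : Type) k (f : 'I_k -> T) :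
  size [seq f i | i <- enum 'I_k] = k.
Proof. by rewrite size_map size_enum_ord. Qed.

Lemma nth_cat_addn (T : Type) (x0 : T) s1 s2 k j :
  size s1 = k -> nth x0 (s1 ++ s2) (k + j) = nth x0 s2 j.
Proof. by move=> <-; rewrite nth_cat ltnNge leq_addr addKn. Qed.

Lemma incidenceE (r s t : nat) : r != s ->
  (if t == r then 1 else if t == s then -1 else 0) = (r == t)%:Z - (s == t)%:Z :> int.
Proof.
rewrite !(eq_sym t); case: (eqVneq r t) => [->|_ _]; last by case: (s == t).
by rewrite eq_sym => /negbTE ->.
Qed.

(** * From auctions to networks *)

Section Encoding.

Variable X : auction.
Notation nt := (nT X).
Notation K := (nI X).

Let L := encoding_length X.

Lemma encode_small z : z \in encode X -> (`|z| < 2 ^ L)%N.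
Proof.
move=> zX; have L0 : (bitsize z <= L)%N.
  by rewrite /L /encoding_length (perm_big _ (perm_to_rem zX)) big_cons leq_addr.
by rewrite -bitsize_le // (leq_trans _ L0).
Qed.

Lemma size_encode : size (encode X) = (2 + nt + K + 2 * (K * nt) + K)%N.
Proof.
by rewrite /encode !size_cat !size_allpairs !size_map_enum_ord !size_enum_ord /=; lia.
Qed.

Lemma size_encode_le : (size (encode X) <= L)%N.
Proof.
rewrite /L /encoding_length -sum1_size; apply: leq_sum => z _; exact: bitsize_gt0.
Qed.

Lemma encode_Q (i : 'I_K) (t : 'I_nt) :
  nth 0 (encode X) (2 + nt + K + (i * nt + t)) = Q i t.
Proof.
have lt : (i * nt + t < K * nt)%N by have := ltn_ord i; have := ltn_ord t; nia.
rewrite -!addnA /encode nth_cat_addn // !(nth_cat_addn _ _ _ (size_map_enum_ord _)).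
rewrite nth_cat size_allpairs !size_enum_ord lt.
have := @nth_allpairs _ _ _ (@Q X) (enum 'I_K) (enum 'I_nt) 0 i t i t.
by rewrite !size_enum_ord !nth_ord_enum; apply.
Qed.

Lemma encode_p (i : 'I_K) (t : 'I_nt) :
  nth 0 (encode X) (2 + nt + K + K * nt + (i * nt + t)) = p i t.
Proof.
have lt : (i * nt + t < K * nt)%N by have := ltn_ord i; have := ltn_ord t; nia.
have sz M : size [seq M i t : int | i <- enum 'I_K, t <- enum 'I_nt] = (K * nt)%N.
  by rewrite size_allpairs !size_enum_ord.
rewrite -!addnA /encode nth_cat_addn // !(nth_cat_addn _ _ _ (size_map_enum_ord _)).
rewrite (nth_cat_addn _ _ _ (sz _)) nth_cat sz lt.
have := @nth_allpairs _ _ _ (@p X) (enum 'I_K) (enum 'I_nt) 0 i t i t.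
by rewrite !size_enum_ord !nth_ord_enum; apply.
Qed.

Lemma encode_max_qty (i : 'I_K) :
  nth 0 (encode X) (2 + nt + K + 2 * (K * nt) + i) = max_qty i.
Proof.
have sz M : size [seq M i t : int | i <- enum 'I_K, t <- enum 'I_nt] = (K * nt)%N.
  by rewrite size_allpairs !size_enum_ord.
rewrite mul2n -addnn -!addnA /encode nth_cat_addn //.
rewrite !(nth_cat_addn _ _ _ (size_map_enum_ord _)) !(nth_cat_addn _ _ _ (sz _)).
by rewrite (nth_map i) ?size_enum_ord // nth_ord_enum.
Qed.

(** The network is indexed by natural numbers, like memory cells. Values outside the index range are
    arbitrary, every use being guarded by [j < K]. *)
Definition demand_node j : nat := oapp (fun i : 'I_K => val (demand i)) 0%N (insub j).
Definition offer_node j : nat := oapp (fun i : 'I_K => val (offer i)) 0%N (insub j).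
Definition capacity j : int := oapp (fun i : 'I_K => max_qty i) 0 (insub j).
Definition entry (M : 'I_K -> 'I_nt -> int) j t : int :=
  nth 0 [seq nth 0 [seq M i t | t <- enum 'I_nt] t | i <- enum 'I_K] j.

Lemma demand_nodeE (i : 'I_K) : demand_node i = demand i.
Proof. by rewrite /demand_node valK. Qed.
Lemma offer_nodeE (i : 'I_K) : offer_node i = offer i.
Proof. by rewrite /offer_node valK. Qed.
Lemma capacityE (i : 'I_K) : capacity i = max_qty i.
Proof. by rewrite /capacity valK. Qed.
Lemma entryE M (i : 'I_K) (t : 'I_nt) : entry M i t = M i t.
Proof.
by rewrite /entry (nth_map i) ?size_enum_ord // (nth_map t) ?size_enum_ord // !nth_ord_enum.
Qed.

Lemma demand_node_lt j : (j < K)%N -> (demand_node j < nt.+1)%N.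
Proof. by move=> jK; rewrite (demand_nodeE (Ordinal jK)). Qed.
Lemma offer_node_lt j : (j < K)%N -> (offer_node j < nt.+1)%N.
Proof. by move=> jK; rewrite (offer_nodeE (Ordinal jK)). Qed.
Lemma demand_neq_offer_node j : (j < K)%N -> demand_node j != offer_node j.
Proof.
move=> jK; rewrite (demand_nodeE (Ordinal jK)) (offer_nodeE (Ordinal jK)).
exact: demand_neq_offer.
Qed.

Lemma Q_node (i : 'I_K) (t : 'I_nt) : Q i t =
  if t == demand_node i :> nat then 1 else if t == offer_node i :> nat then -1 else 0.
Proof. by rewrite demand_nodeE offer_nodeE. Qed.

Notation excess := (excess K demand_node offer_node).
Notation cost := (cost nt (entry (@Q X)) (entry (@p X))).
Notation reduced := (reduced demand_node offer_node cost).

Lemma clearing_excess (d : nat -> int) (t : 'I_nt) :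
  \sum_(i < K) Q i t * d i = excess d t.
Proof.
apply: eq_bigr => i _; rewrite mulrC Q_node; congr (_ * _).
exact: incidenceE (demand_neq_offer_node (ltn_ord i)).
Qed.

Lemma sum_pick (a : nat -> int) (v : nat) :
  \sum_(t < nt) a t * (v == t)%:Z = if (v < nt)%N then a v else 0.
Proof.
case: ltnP => [vt|tv].
  rewrite (bigD1 (Ordinal vt)) //= eqxx mulr1 big1 ?addr0 // => t.
  by rewrite eq_sym -[(v == t :> nat)]/(Ordinal vt == t) => /negbTE ->; rewrite mulr0.
apply: big1 => t _; rewrite gtn_eqF ?mulr0 //; exact: leq_trans tv.
Qed.

(** An end at the added maximum is missing from the sum over contracts; its shifted potential
    [P nt - P nt] is 0, so the two sides agree there as well. *)
Lemma surplus_reduced (pi : 'I_nt -> int) (P : nat -> int) (i : 'I_K) :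
  (forall t : 'I_nt, pi t = P t - P nt) -> surplus pi i = reduced P i.
Proof.
move=> piP; rewrite /surplus /reduced /cost.
under eq_bigr do rewrite mulrBl.
rewrite sumrB -addrA; congr (_ + _).
  by apply: eq_bigr => t _; rewrite !entryE.
have RN := demand_node_lt (ltn_ord i); have SN := offer_node_lt (ltn_ord i).
have -> : \sum_(t < nt) pi t * Q i t =
   \sum_(t < nt) ((P t - P nt) * (demand_node i == t)%:Z -
                  (P t - P nt) * (offer_node i == t)%:Z).
  apply: eq_bigr => t _; rewrite piP Q_node -mulrBr; congr (_ * _).
  exact: incidenceE (demand_neq_offer_node (ltn_ord i)).
rewrite sumrB !(sum_pick (fun t => P t - P nt)).
case: ltnP => hR; case: ltnP => hS.
- by ring.
- have -> : offer_node i = nt by lia. by ring.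
- have -> : demand_node i = nt by lia. by ring.
- have -> : demand_node i = nt by lia. have -> : offer_node i = nt by lia. by ring.
Qed.

(** Every arc adds to the excess of one vertex what it takes from another, so all excesses sum to 0
    and the last one vanishes with the others. *)
Lemma balanced_of_clearing (d : nat -> int) :
  (forall t, (t < nt)%N -> excess d t = 0) ->
  balanced nt.+1 K demand_node offer_node d.
Proof.
move=> H; have tot : \sum_(v < nt.+1) excess d v = 0.
  rewrite exchange_big /=; apply: big1 => j _; rewrite -mulr_sumr.
  have one (u : nat) : (u < nt.+1)%N -> \sum_(v < nt.+1) (u == v)%:Z = 1.
    move=> uN; rewrite (bigD1 (Ordinal uN)) //= eqxx big1 ?addr0 // => v.
    by rewrite eq_sym -[(u == v :> nat)]/(Ordinal uN == v) => /negbTE ->.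
  by rewrite sumrB !one ?subrr ?mulr0 // ?demand_node_lt ?offer_node_lt.
move=> v; rewrite ltnS leq_eqVlt => /orP[/eqP->|]; last exact: H.
move: tot; rewrite big_ord_recr /= big1 ?add0r // => t _; exact: H.
Qed.

Lemma feasible_slackness (d : nat -> int) (pi : 'I_nt -> int) (P : nat -> int) :
  (forall t : 'I_nt, pi t = P t - P nt) ->
  feasible (fun i : 'I_K => d i) pi <->
  slackness K demand_node offer_node cost capacity d P /\
  balanced nt.+1 K demand_node offer_node d.
Proof.
move=> piP; split=> [[clear qty pos neg]|[cs bal]].
  split.
    move=> j jK; have := qty (Ordinal jK); have := pos (Ordinal jK); have := neg (Ordinal jK).
    by rewrite (surplus_reduced _ piP) -capacityE /=.
  apply: balanced_of_clearing => t tn.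
  by rewrite -[RHS](clear (Ordinal tn)) clearing_excess.
split=> [t|i|i|i].
- by rewrite clearing_excess bal // ltnS ltnW.
- by have [] := cs i (ltn_ord i); rewrite capacityE.
- by rewrite (surplus_reduced _ piP); have [] := cs i (ltn_ord i).
- by rewrite (surplus_reduced _ piP) -capacityE; have [] := cs i (ltn_ord i).
Qed.

Lemma optimal_of_slackness (m : memory) (P : nat -> int) :
  (forall t, (t < nt)%N -> m 2%N t%:Z = P t - P nt) ->
  slackness K demand_node offer_node cost capacity (fun j => m 1%N j%:Z) P ->
  balanced nt.+1 K demand_node offer_node (fun j => m 1%N j%:Z) ->
  (forall d pi, slackness K demand_node offer_node cost capacity d pi ->
    balanced nt.+1 K demand_node offer_node d ->
    \sum_(j < K) d j <= \sum_(j < K) m 1%N j%:Z) ->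
  optimal (output_delta X m) (output_pi X m).
Proof.
move=> outP cs bal opt; split.
  have piP t : output_pi X m t = P t - P nt by exact: (outP t (ltn_ord t)).
  exact: ((feasible_slackness (fun j => m 1%N j%:Z) piP).2 (conj cs bal)).
move=> d pi feas.
(* Extension by 0 beyond the index range; in particular [P' nt] is 0, so [pi] is already
   normalized. *)
pose d' j : int := oapp d 0 (insub j).
pose P' j : int := oapp pi 0 (insub j).
have d'E i : d' (val i) = d i by rewrite /d' valK.
have P'E (t : 'I_nt) : pi t = P' t - P' nt.
  by rewrite /P' valK insubF ?ltnn // subr0.
have feas' : feasible (fun i : 'I_K => d' i) pi.
  case: feas => h1 h2 h3 h4; split=> [t|i|i|i]; rewrite ?d'E //; last 2 first.
  - exact: h3.
  - exact: h4.
  by rewrite -[RHS](h1 t); apply: eq_bigr => i _; rewrite d'E.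
have [cs' bal'] := (feasible_slackness d' P'E).1 feas'.
by under eq_bigr do rewrite -d'E; apply: opt cs' bal'.
Qed.

End Encoding.

(** Gains are at most [2 ^ (4 * L + 1)], and prices exceed this by at most
    [4 ^ (2 * L * (nI * (nT + 1)))], where [nI <= L] and [nT <= L]. One more bit is for differences
    of prices and one for strictness. *)
Definition bit_bound (L : nat) : nat := 4 * L + 3 + 4 * (L * L * (L + 1)).
(** Covers loops over the orders, over the [nT + 1] vertices, and over the at most [2 * L]
    scales. *)
Definition loop_bound (L : nat) : nat := 2 * L + 1.

Lemma auction_solver_correct X : let L := encoding_length X in
  wp (bit_bound L) (loop_bound L) auction_solver (init_memory (encode X))
    (fun m => optimal (output_delta X m) (output_pi X m)).
Proof.
move=> L; set b := bit_bound L; set n := loop_bound L.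
have sizeL : (2 + nT X + nI X + 2 * (nI X * nT X) + nI X <= L)%N.
  by rewrite -size_encode size_encode_le.
have in_enc j : (j < size (encode X))%N -> (`|(nth 0 (encode X) j)%R| < 2 ^ L)%N.
  by move=> jX; apply: encode_small; apply: mem_nth.
have LL : (L < 2 ^ L)%N by apply: ltn_expl.
have bb : (b < 2 ^ b)%N by apply: ltn_expl.
have powS (x k : nat) : (x < 2 ^ k -> x + x < 2 ^ k.+1)%N by rewrite expnS; lia.
have pA i t : (i < nI X)%N -> (t < nT X)%N -> (`|entry (@p X) i t| <= 2 ^ L)%N.
  move=> iK tn; rewrite (entryE _ (Ordinal iK) (Ordinal tn)) -encode_p.
  apply/ltnW/in_enc; rewrite size_encode /=; nia.
have Ub i : (i < nI X)%N -> 0 < capacity X i < (2 ^ L)%N%:Z.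
  move=> iK; have H : (`|max_qty (Ordinal iK)| < 2 ^ L)%N.
    by rewrite -encode_max_qty in_enc // size_encode /=; lia.
  by have := max_qty_gt0 (Ordinal iK); rewrite (capacityE (Ordinal iK)); lia.
have cost_b i : (i < nI X)%N ->
   (`|cost (nT X) (entry (@Q X)) (entry (@p X)) i| <= nT X * 2 ^ L)%N.
  move=> iK; rewrite /cost; move: (leqnn (nT X)).
  have : forall k, (k <= nT X)%N ->
     (`|(\sum_(t < k) entry (@p X) i t * entry (@Q X) i t)%R| <= k * 2 ^ L)%N.
    elim=> [|k IH] kn; first by rewrite big_ord0.
    have tri (x y : int) : (`|(x + y)%R| <= `|x| + `|y|)%N by lia.
    rewrite big_ord_recr /= mulSn; apply: leq_trans (tri _ _) _.
    rewrite addnC leq_add ?IH ?(ltnW kn) //.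
    rewrite abszM [X in (_ * `|X|)%N](entryE _ (Ordinal iK) (Ordinal kn)) /Q.
    by have := pA i k iK kn; case: ifP => _; [|case: ifP => _]; lia.
  by move=> H; apply: H.
(* Each of the [nI] capacities is below [2 ^ L], and [nI + 1 <= 2 ^ L]. *)
have Mb : (`|max_total (nI X) (capacity X)| <= 2 ^ (2 * L))%N.
  have : \sum_(j < nI X) capacity X j <= \sum_(j < nI X) (2 ^ L)%N%:Z.
    by apply: ler_sum => j _; have /andP[_ /ltW] := Ub j (ltn_ord j).
  have : 0 <= \sum_(j < nI X) capacity X j.
    by apply: sumr_ge0 => j _; have /andP[/ltW] := Ub j (ltn_ord j).
  rewrite sumr_const card_ord /max_total mul2n -addnn expnD -mulr_natr => h1 h2.
  by nia.
have W_b : (2 ^ (4 * L + 1) * 4 ^ (2 * L * (nI X * (nT X).+1)) * 2 < 2 ^ b)%N.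
  have -> : 4%N = (2 ^ 2)%N by [].
  rewrite -expnM -expnD -expnSr ltn_exp2l // /b /bit_bound.
  by nia.
apply: (@wp_weaken b n _ _ (fun m' => exists pi,
    [/\ forall t, (t < nT X)%N -> m' 2%N t%:Z = pi t - pi (nT X),
        slackness (nI X) (demand_node X) (offer_node X)
          (cost (nT X) (entry (@Q X)) (entry (@p X))) (capacity X) (fun j => m' 1%N j%:Z) pi,
        balanced (nT X).+1 (nI X) (demand_node X) (offer_node X) (fun j => m' 1%N j%:Z)
      & forall d pi', slackness (nI X) (demand_node X) (offer_node X)
          (cost (nT X) (entry (@Q X)) (entry (@p X))) (capacity X) d pi' ->
          balanced (nT X).+1 (nI X) (demand_node X) (offer_node X) d ->
          \sum_(j < nI X) d j <= \sum_(j < nI X) m' 1%N j%:Z])); last first.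
  by move=> m' _ [pi [h1 h2 h3 h4]]; apply: optimal_of_slackness h1 h2 h3 h4.
apply: (@auction_solver_spec b n (nT X) (nI X) (demand_node X) (offer_node X)
  (capacity X) _ _ _ _ _ _ _ (entry (@Q X)) (entry (@p X)) _ _
  (2 ^ L) (2 ^ (4 * L + 1)) (2 * L)) => //.
- by rewrite /b /bit_bound addn3 addSn.
- by apply: leq_ltn_trans bb; rewrite /n /loop_bound /b /bit_bound; lia.
- by rewrite /n /loop_bound; lia.
- by rewrite /n /loop_bound; lia.
- exact: demand_node_lt.
- exact: offer_node_lt.
- exact: demand_neq_offer_node.
- move=> j t jK tn; rewrite (entryE _ (Ordinal jK) (Ordinal tn)).
  exact: (Q_node (Ordinal jK) (Ordinal tn)).
- rewrite /input /init_memory /=; split=> //.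
  + move=> j t jK tn; rewrite (entryE _ (Ordinal jK) (Ordinal tn)).
    exact: (encode_Q (Ordinal jK) (Ordinal tn)).
  + move=> j t jK tn; rewrite (entryE _ (Ordinal jK) (Ordinal tn)).
    exact: (encode_p (Ordinal jK) (Ordinal tn)).
  + move=> j jK; rewrite (capacityE (Ordinal jK)).
    exact: (encode_max_qty (Ordinal jK)).
- by move=> j jK; have /andP[/ltW] := Ub j jK.
- apply: (@leq_ltn_trans (2 ^ L * 2 ^ L)%N); first by rewrite leq_mul2r; apply/orP; right; lia.
  by rewrite -expnD ltn_exp2l // /b /bit_bound; lia.
- by rewrite /n /loop_bound; lia.
- by rewrite /b /bit_bound; lia.
(* The exponent [4 * L] collects [2 * L] for the total capacity, [L] for the number of contracts
   summed over and [L] for a limit price. *)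
- move=> j jK; rewrite addn1 expnS.
  have : (`|max_total (nI X) (capacity X)| *
     `|cost (nT X) (entry (@Q X)) (entry (@p X)) j| <= 2 ^ (2 * L) * (2 ^ L * 2 ^ L))%N.
    apply: leq_mul Mb (leq_trans (cost_b j jK) _).
    by rewrite leq_mul2r; apply/orP; right; lia.
  rewrite -!expnD; have -> : (2 * L + (L + L) = 4 * L)%N by lia.
  by have := expn_gt0 2 (4 * L); lia.
Qed.

Close Scope ring_scope.

Theorem mainTheorem2 :
  exists (algorithm : program) (c d : nat),
    forall X : auction,
      exists (m : memory) (time : nat),
        [/\ exec algorithm (init_memory (encode X)) m time,
            (time <= c * encoding_length X ^ d + c)%N
          & optimal (output_delta X m) (output_pi X m)].
Proof.
have bitP : poly_bounded bit_bound.
  have id1 := poly_bounded_id; have k x := poly_bounded_const x.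
  apply: poly_boundedD; first by apply: poly_boundedD => //; apply: poly_boundedM.
  apply: poly_boundedM => //; apply: poly_boundedM; first exact: poly_boundedM.
  exact: poly_boundedD.
have loopP : poly_bounded loop_bound.
  have id1 := poly_bounded_id; have k x := poly_bounded_const x.
  by apply: poly_boundedD => //; apply: poly_boundedM.
have [c [d cost_le]] :=
  poly_boundedM (poly_bounded_prog_cost auction_solver loopP) (poly_boundedX 2 bitP).
exists auction_solver, c, d => X.
have [|m [k [run le _ opt]]] := auction_solver_correct (X := X).
  (* Initially a cell holds a number of the encoding, below [2 ^ L], or the default 0. *)
  move=> a j; rewrite /init_memory; case: ifP => _; last by rewrite expn_gt0.
  case: (ltnP `|j|%N (size (encode X))) => [lt|ge]; last by rewrite nth_default // expn_gt0.
  apply: (leq_trans (encode_small (mem_nth _ lt))).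
  by rewrite leq_exp2l // /bit_bound; lia.
by exists m, k; split=> //; apply: leq_trans le (cost_le _).
Qed.
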